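(* Assume that $\mathbb{E}[e^{\gamma\omega(0)}]<\infty$ for some $\gamma>0$. In addition, if $d=2$, suppose that the law of $\omega(0)$ has strictly positive support. Then there exist constants $0<C_1,C_2<\infty$ such that for all sufficiently large $x\in\mathbb{Z}^d$ (i.e. all $x\in\mathbb{Z}^d$ with $\|x\|_1$ large enough) and for all $t\ge 0$, $$\mathbb{P}\bigl(a(0,x)-\mathbb{E}[a(0,x)]\ge t\|x\|_1^{1/2}\bigr)\le C_1e^{-C_2t}.$$
   Context: Let $d\ge 2$ and let $(S_k)_{k\ge0}$ be the simple random walk on $\mathbb{Z}^d$; $P^x$ and $E^x$ denote its law and expectation when started at $x$. Let $\Omega=[0,\infty)^{\mathbb{Z}^d}$ with the canonical $\sigma$-field and let $\mathbb{P}$ be a product probability measure on $\Omega$ under which the coordinates $\omega(x)$, $x\in\mathbb{Z}^d$, of $\omega\in\Omega$ (the potential) are i.i.d.; $\mathbb{E}$ is the expectation under $\mathbb{P}$. It is assumed throughout that $\omega(0)$ is not almost surely equal to $0$. ''The law of $\omega(0)$ has strictly positive support'' means that its (closed) support is contained in $(0,\infty)$. For $y\in\mathbb{Z}^d$ let $H(y)=\inf\{k\ge0: S_k=y\}$. For $x,y\in\mathbb{Z}^d$ set $$e(x,y)=e(x,y,\omega)=E^x\Bigl[\exp\Bigl\{-\sum_{k=0}^{H(y)-1}\omega(S_k)\Bigr\}\mathbf{1}_{\{H(y)<\infty\}}\Bigr]$$ (with $e(x,x)=1$), and define the travel cost $a(x,y)=a(x,y,\omega)=-\log e(x,y,\omega)$.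 $\|\cdot\|_1$ is the $\ell^1$-norm. *)

(* Defs.v *)
From HB Require Import structures.
From mathcomp Require Import all_boot all_order all_algebra.
From mathcomp Require Import all_classical all_reals all_analysis.

Set Implicit Arguments.
Unset Strict Implicit.
Unset Printing Implicit Defensive.

Import Order.TTheory GRing.Theory Num.Theory.
Import numFieldNormedType.Exports.

Local Open Scope classical_set_scope.
Local Open Scope ring_scope.

Definition lattice (d : nat) := 'rV[int]_d.

HB.instance Definition _ d := GRing.Zmodule.on (lattice d).
HB.instance Definition _ d := isPointed.Build (lattice d) 0.
HB.instance Definition _ d := @isMeasurable.Build default_measure_display
  (lattice d) discrete_measurable discrete_measurable0
  discrete_measurableC discrete_measurableU.

Definition l1norm (d : nat) (x : lattice d) : nat :=
  (\sum_(i < d) `|(x : 'rV[int]_d) ord0 i|)%N.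

(* The bare set [0, +oo)^(Z^d); `potential` below is the same set carrying the
   sigma-algebra generated by the coordinate maps. *)
Definition raw_potential (R : realType) (d : nat) := lattice d -> {nonneg R}.

HB.instance Definition _ R d := Choice.on (raw_potential R d).
HB.instance Definition _ R d :=
  isPointed.Build (raw_potential R d) (fun=> 0%:nng).

Definition cylinders (R : realType) (d : nat) : set (set (raw_potential R d)) :=
  [set A | exists (x : lattice d) (B : set R),
     measurable B /\ A = [set omega | B (omega x)%:num]].

Notation potential R d := (g_sigma_algebraType (@cylinders R d)).

Definition site (R : realType) (d : nat) (x : lattice d)
  (omega : potential R d) : R := ((omega : raw_potential R d) x)%:num.

Lemma measurable_site (R : realType) (d : nat) (x : lattice d) :
  measurable_fun setT (@site R d x).
Proof.
by move=> _ B mB; rewrite setTI; apply: sub_gen_smallest; exists x, B.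
Qed.

HB.instance Definition _ (R : realType) (d : nat) (x : lattice d) :=
  isMeasurableFun.Build _ _ _ _ (@site R d x) (measurable_site x).

Definition mutually_independent (R : realType) dT (T : measurableType dT)
    (P : probability T R) (I : choiceType) dU (U : measurableType dU)
    (X : I -> T -> U) : Prop :=
  forall (J : seq I) (B : I -> set U), uniq J ->
    (forall i, measurable (B i)) ->
    P (\bigcap_(i in [set` J]) (X i @^-1` B i)) =
    (\prod_(i <- J) P (X i @^-1` B i))%E.

Definition identically_distributed (R : realType) dT (T : measurableType dT)
    (P : probability T R) (I : Type) dU (U : measurableType dU)
    (X : I -> T -> U) : Prop :=
  forall (i j : I) (B : set U), measurable B ->
    P (X i @^-1` B) = P (X j @^-1` B).

Definition topological_support (R : realType) (mu : set R -> \bar R) : set R :=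
  [set u | forall V : set R, open V -> V u -> (0 < mu V)%E].

Definition simple_random_walk (R : realType) (d : nat) dW
    (W : measurableType dW) (S : nat -> W -> lattice d) (x : lattice d)
    (P : probability W R) : Prop :=
  [/\ forall k, measurable_fun setT (S k),
      P [set w | S 0%N w = x] = 1%E,
      mutually_independent P (fun k w => S k.+1 w - S k w) &
      forall k z, P [set w | S k.+1 w - S k w = z] =
        (if l1norm z == 1%N then ((2 * d)%:R^-1)%:E else 0%E)].

(* First hitting time of y along the trajectory s; None stands for +oo. *)
Definition hitting_time (d : nat) (s : nat -> lattice d) (y : lattice d) :
    option nat :=
  if pselect (exists k, s k == y) is left hit then Some (ex_minn hit) else None.

Definition travel_weight (R : realType) (d : nat) (omega : potential R d)
    (y : lattice d) (s : nat -> lattice d) : R :=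
  if hitting_time s y is Some n
  then expR (- \sum_(k < n) site (s k) omega) else 0.

Section travel_cost.
Variables (R : realType) (d : nat) (dW : measure_display).
Variables (W : measurableType dW) (S : nat -> W -> lattice d).
Variable Px : lattice d -> probability W R.

(* The expectation lies in [0, 1], hence is finite. *)
Definition travel_e (x y : lattice d) (omega : potential R d) : R :=
  fine 'E_(Px x)[fun w => travel_weight omega y (S ^~ w)].

(* For a simple random walk and d > 0, travel_e is positive: the potential is
   finite and y is reached with positive probability; ln 0 is never used. *)
Definition travel_cost (x y : lattice d) (omega : potential R d) : R :=
  - ln (travel_e x y omega).

End travel_cost.

(* Main.v *)
Require Import Defs.
From HB Require Import structures.
From mathcomp Require Import all_boot all_order all_algebra.
From mathcomp Require Import all_classical all_reals all_analysis.
From mathcomp Require Import measurable_realfun ring lra zify.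

Set Implicit Arguments.
Unset Strict Implicit.
Unset Printing Implicit Defensive.

Import Order.TTheory GRing.Theory Num.Theory.
Import numFieldNormedType.Exports.

Local Open Scope classical_set_scope.
Local Open Scope ring_scope.

(** Write [n] for the l1 norm of [x].  The travel cost is minus the logarithm of a
sum over paths from 0 to [x]; this sum also defines a path measure, and [q z]
denotes the probability that a path drawn from it visits [z].

Exponential tails on the scale of the square root of [n] come from a variance
bound for exponentials.  Suppose that a bounded variable [Y] satisfies
[E exp(l Y) <= (E exp(l Y / 2)) ^ 2 + D n l ^ 2 E exp(l Y)] for small [l].  Then
halving [l] repeatedly shows that [E exp(l (Y - E Y))] is bounded when [l] is a
small multiple of [n ^ (-1/2)] ([mgf_le]), and Markov's inequality concludes
([chernoff_bound]).

The variance bound for [Y] the travel cost comes from the Efron-Stein inequality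
applied to [exp(l Y / 2)] ([Efron_Stein]): one has to control, summed over the
sites, the squared increase of [Y] when one site is resampled.  Giving the site
[z] the value [v] raises the cost by at most [q z * (v + ln K)]
([cost_increase]).  Here [K] bounds the weight of the loops that a path can make
at [z]; in dimension at least 3 it is finite by transience
([loops_bounded_transience]), and in dimension 2 because the potential is bounded
away from 0 ([loops_bounded_killing]).  Hence the variance is at most a constant
times [l ^ 2 E ((\sum_z q z) exp(l Y))].

The sum of the [q z] is the mean number of sites visited by the path, and it is
of order [n].  Indeed, since the sites are independent, each newly visited site
multiplies the mean weight of a path by at most [E exp(- omega 0) < 1].  So the
sum over paths still has mean at most 1 when every visited site is rewarded by a
small factor [exp(eps)] ([integral_range_weight]); by Jensen's inequality this
gives [exp(eps * \sum_z q z - Y) <= r] with [E r <= 1] ([visited_le]).  As [Y] has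
exponential moments of order [n], by comparison with one direct path
([integral_expR_truncated_cost]), the part of [\sum_z q z] beyond a multiple of
[n] is negligible ([mean_visits_le]).

All this is done for the walk stopped after [N] steps, for which path sums are
finite expressions in finitely many sites, and for a capped cost, which is
bounded.  The costs so obtained decrease to the travel cost, and an upper tail
bound passes to the limit ([travel_cost_tail]). *)

(** * Path sums of the walk stopped after finitely many steps *)

Definition step {d : nat} (s : 'I_d * bool) : lattice d :=
  if s.2 then delta_mx 0 s.1 : 'rV[int]_d else - (delta_mx 0 s.1 : 'rV[int]_d).

Definition avg {R : realType} {d : nat} (g : lattice d -> R) (y : lattice d)
  : R := (2 * d)%:R^-1 * \sum_(s : 'I_d * bool) g (y + step s).

Section Average.
Context {R : realType} {d : nat}.
Implicit Types (f g : lattice d -> R) (y : lattice d).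

Lemma avg_le f g y : (forall u, f u <= g u) -> avg f y <= avg g y.
Proof. by move=> fg; rewrite ler_wpM2l// ler_sum. Qed.

Lemma avg_ge0 g y : (forall u, 0 <= g u) -> 0 <= avg g y.
Proof. by move=> g0; rewrite mulr_ge0// sumr_ge0. Qed.

Lemma avgD f g y : avg (fun u => f u + g u) y = avg f y + avg g y.
Proof. by rewrite /avg big_split mulrDr. Qed.

Lemma avgZ a g y : avg (fun u => a * g u) y = a * avg g y.
Proof. by rewrite /avg -mulr_sumr mulrCA. Qed.

Lemma avg_sum (I : Type) (r : seq I) (p : pred I) (F : I -> lattice d -> R) y :
  avg (fun u => \sum_(i <- r | p i) F i u) y = \sum_(i <- r | p i) avg (F i) y.
Proof. by rewrite /avg exchange_big mulr_sumr. Qed.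

Lemma card_step : #|{: 'I_d * bool}| = (2 * d)%N.
Proof. by rewrite card_prod card_ord card_bool mulnC. Qed.

Lemma avg_cst (d0 : (0 < d)%N) (a : R) y : avg (fun=> a) y = a.
Proof.
rewrite /avg sumr_const card_step -[a *+ _]mulr_natr mulrCA mulVf ?mulr1//.
by rewrite pnatr_eq0 muln_eq0/= -lt0n.
Qed.

Lemma avg_ge_term g y s : (forall u, 0 <= g u) ->
  (2 * d)%:R^-1 * g (y + step s) <= avg g y.
Proof. by move=> g0; rewrite ler_wpM2l// (bigD1 s)//= lerDl sumr_ge0. Qed.

End Average.

Section PathSums.
Context {R : realType} {d : nat}.
Variable x : lattice d.
Implicit Types (V : lattice d -> R) (y z : lattice d) (N : nat).

(** First-step recursions for sums over the nearest-neighbour paths that start at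
[y] and reach [x] for the first time after at most [N] steps.  A path of length
[m] has weight [(2 * d) ^ (- m)] times [expR] of minus the sum of [V] along it,
[x] excluded.  [hit] sums over all paths, [avoid] over those that do not meet
[z], [once] and [visit] over those that meet [z] exactly once and at least once.
By convention [visit] vanishes for [z = x]. *)
Fixpoint hit V N y : R :=
  if y == x then 1
  else if N is M.+1 then expR (- V y) * avg (hit V M) y else 0.

Fixpoint avoid V z N y : R :=
  if y == x then 1
  else if y == z then 0
  else if N is M.+1 then expR (- V y) * avg (avoid V z M) y else 0.

Fixpoint once V z N y : R :=
  if y == x then 0
  else if N is M.+1 then
    expR (- V y) * avg (if y == z then avoid V z M else once V z M) y
  else 0.

Fixpoint visit V z N y : R :=
  if y == x then 0
  else if y == z then hit V N y
  else if N is M.+1 then expR (- V y) * avg (visit V z M) y else 0.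

(** The finitely many sites on which [hit V N y] can depend. *)
Fixpoint reach N y : seq (lattice d) :=
  y :: if N is M.+1 then flatten [seq reach M (y + step s) | s <- enum {: 'I_d * bool}]
       else [::].

Lemma hit_target V N : hit V N x = 1.
Proof. by case: N => [|N] /=; rewrite eqxx. Qed.

Lemma hitS V N y : y != x -> hit V N.+1 y = expR (- V y) * avg (hit V N) y.
Proof. by move=> /negPf /= ->. Qed.

Lemma hit0 V y : y != x -> hit V 0 y = 0.
Proof. by move=> /negPf /= ->. Qed.

Lemma hit_ge0 V N y : 0 <= hit V N y.
Proof.
elim: N y => [|N IH] y /=; case: ifP => // _.
by rewrite mulr_ge0// avg_ge0.
Qed.

Lemma avoid_ge0 V z N y : 0 <= avoid V z N y.
Proof.
elim: N y => [|N IH] y /=; do 2 case: ifP => //= _.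
by rewrite mulr_ge0// avg_ge0.
Qed.

Lemma once_ge0 V z N y : 0 <= once V z N y.
Proof.
elim: N y => [|N IH] y /=; case: ifP => //= _.
rewrite mulr_ge0// avg_ge0// => u; case: ifP => _; [exact: avoid_ge0|exact: IH].
Qed.

Lemma visit_ge0 V z N y : 0 <= visit V z N y.
Proof.
elim: N y => [|N IH] y; rewrite [visit _ _ _ _]/=; case: ifP => // _.
  by case: ifP => // _; exact: (hit_ge0 V 0).
case: ifP => _; first exact: (hit_ge0 V N.+1).
by rewrite mulr_ge0// avg_ge0.
Qed.

Lemma hit_le1 (d0 : (0 < d)%N) V N y : (forall u, 0 <= V u) -> hit V N y <= 1.
Proof.
move=> V0; elim: N y => [|N IH] y /=; case: ifP => //= _.
rewrite -[leRHS]mulr1 ler_pM ?expR_ge0 ?avg_ge0//.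
- by move=> u; exact: hit_ge0.
- by rewrite expR_le1 oppr_le0.
- by rewrite -[leRHS](avg_cst d0 1 y) avg_le.
Qed.

Lemma avoid_mono V z N y : avoid V z N y <= avoid V z N.+1 y.
Proof.
elim: N y => [|N IH] y.
  by rewrite /=; do 2 case: ifP => //= _; rewrite mulr_ge0// avg_ge0// => u;
    exact: (avoid_ge0 V z 0).
rewrite [leLHS]/= [leRHS]/=; do 2 case: ifP => //= _.
by rewrite ler_wpM2l ?expR_ge0// avg_le.
Qed.

Lemma once_mono V z N y : once V z N y <= once V z N.+1 y.
Proof.
elim: N y => [|N IH] y.
  by apply: le_trans (once_ge0 V z 1 y); rewrite /=; case: ifP.
rewrite [leLHS]/= [leRHS]/=; case: ifP => //= _.
rewrite ler_wpM2l ?expR_ge0// avg_le// => u.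
by case: ifP => // _; exact: avoid_mono.
Qed.

Lemma hit_mono V N y : hit V N y <= hit V N.+1 y.
Proof.
elim: N y => [|N IH] y.
  have [->|yx] := eqVneq y x; first by rewrite !hit_target.
  by rewrite hit0// hit_ge0.
rewrite [leLHS]/= [leRHS]/=; case: ifP => //= _.
by rewrite ler_wpM2l ?expR_ge0// avg_le.
Qed.

Lemma hit_antitone V V' N y : (forall u, V u <= V' u) -> hit V' N y <= hit V N y.
Proof.
move=> VV'; elim: N y => [|N IH] y /=; case: ifP => //= _.
rewrite ler_pM ?expR_ge0 ?avg_le ?avg_ge0//; first by move=> u; exact: hit_ge0.
by rewrite ler_expR lerN2.
Qed.

Lemma hit_local V V' N y : {in reach N y, V =1 V'} -> hit V N y = hit V' N y.
Proof.
elim: N y => [//|N IH] y VV' /=; case: ifP => // _.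
rewrite (VV' y (mem_head _ _)); congr (_ * (_ * _)); apply: eq_bigr => s _.
apply: IH => u us; apply: VV'; rewrite /= inE; apply/orP; right.
by apply/flatten_mapP; exists s; rewrite ?mem_enum.
Qed.

Lemma hit_local_target V V' N y : (forall u, u != x -> V u = V' u) ->
  hit V N y = hit V' N y.
Proof.
move=> VV'; elim: N y => [//|N IH] y /=; case: ifP => // /negbT yx.
by rewrite VV'//; congr (_ * (_ * _)); apply: eq_bigr => s _.
Qed.

Lemma hit_split V z N y : z != x ->
  hit V N y = avoid V z N y + visit V z N y.
Proof.
move=> zx; elim: N y => [|N IH] y; rewrite [avoid _ _ _ _]/= [visit _ _ _ _]/=.
  have [->|yx] := eqVneq y x; first by rewrite hit_target addr0.
  by rewrite hit0//; case: ifP => _; rewrite add0r.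
have [->|yx] := eqVneq y x; first by rewrite hit_target addr0.
case: ifP => _; first by rewrite add0r hitS.
rewrite hitS// -mulrDr -avgD; congr (_ * (_ * _)).
by apply: eq_bigr => s _; exact: IH.
Qed.

(** A path that meets [z] consists of its part up to the first visit, a chain of
loops at [z], and a part from [z] to [x] that does not come back.  The
supersolution [f] dominates the Green function of the killed walk at [z] divided
by [K], so that the chains of loops have total weight at most [K]. *)
Lemma hit_le_once V z N f K y : z != x ->
  (forall u, 0 <= f u) -> f z = 1 -> 1 <= K ->
  (forall u, expR (- V u) * avg f u <= f u) ->
  expR (- V z) * avg f z <= 1 - K^-1 ->
  hit V N y <= avoid V z N y + K * once V z N z * f y.
Proof.
move=> zx f0 fz K1 fsup fz1; have K0 : 0 < K := lt_le_trans ltr01 K1.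
elim: N y => [|N IH] y.
  have [->|yx] := eqVneq y x; last first.
    by rewrite hit0// addr_ge0 ?avoid_ge0// ?mulr_ge0 ?once_ge0// ltW.
  by rewrite hit_target [avoid _ _ _ _]/= eqxx lerDl !mulr_ge0 ?once_ge0// ltW.
have [->|yx] := eqVneq y x.
  by rewrite hit_target [avoid _ _ _ _]/= eqxx lerDl !mulr_ge0 ?once_ge0// ltW.
rewrite hitS//.
have step_le : expR (- V y) * avg (hit V N) y <=
    expR (- V y) * avg (avoid V z N) y
    + K * once V z N z * (expR (- V y) * avg f y).
  rewrite [X in _ <= _ + X]mulrCA -mulrDr ler_wpM2l ?expR_ge0//.
  by rewrite -avgZ -avgD avg_le.
apply: (le_trans step_le).
have o0 : 0 <= K * once V z N z by rewrite mulr_ge0 ?once_ge0// ltW.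
have omono : K * once V z N z <= K * once V z N.+1 z.
  by rewrite ler_wpM2l ?once_mono// ltW.
have [yz|yz] := eqVneq y z; last first.
  rewrite [avoid V z N.+1 y]/= (negPf yx) (negPf yz) lerD2l.
  by apply: ler_pM => //; rewrite mulr_ge0// ?expR_ge0 ?avg_ge0.
have onceE : once V z N.+1 z = expR (- V z) * avg (avoid V z N) z.
  by rewrite /= (negPf zx) eqxx.
rewrite yz -onceE fz mulr1 [avoid _ _ _ _]/= (negPf zx) eqxx add0r.
have : K * once V z N z * (expR (- V z) * avg f z)
    <= K * once V z N z * (1 - K^-1) by rewrite ler_wpM2l.
have : (K * once V z N z) * (1 - K^-1) <= K * once V z N.+1 z * (1 - K^-1).
  by rewrite ler_wpM2r// subr_ge0 invf_le1.
have : K * once V z N.+1 z * (1 - K^-1) = K * once V z N.+1 z - once V z N.+1 z.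
  by rewrite mulrBr mulr1 mulrAC divff ?mul1r// gt_eqF.
lra.
Qed.

Lemma visit_le_once V z N f K y : z != x ->
  (forall u, 0 <= f u) -> f z = 1 -> 1 <= K ->
  (forall u, expR (- V u) * avg f u <= f u) ->
  expR (- V z) * avg f z <= 1 - K^-1 ->
  visit V z N y <= K * once V z N y.
Proof.
move=> zx f0 fz K1 fsup fz1; have K0 : 0 < K := lt_le_trans ltr01 K1.
have at_z M : hit V M z <= K * once V z M z.
  rewrite (le_trans (hit_le_once _ _ zx f0 fz K1 fsup fz1))// fz mulr1.
  by case: M => [|M] /=; rewrite (negPf zx) eqxx add0r.
elim: N y => [|N IH] y; rewrite [visit _ _ _ _]/=.
  have [->|yx] := eqVneq y x; first by rewrite mulr_ge0 ?once_ge0// ltW.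
  have [yz|_] := eqVneq y z; last by rewrite mulr_ge0 ?once_ge0// ltW.
  by have := at_z 0; rewrite -yz [hit _ _ _]/= (negPf yx).
have [->|yx] := eqVneq y x; first by rewrite mulr_ge0 ?once_ge0// ltW.
have [yz|yz] := eqVneq y z; first by have := at_z N.+1; rewrite -yz hitS.
rewrite [once _ _ _ _]/= (negPf yx) (negPf yz) [leRHS]mulrCA ler_wpM2l ?expR_ge0//.
by rewrite -avgZ avg_le.
Qed.

(** Raising [V] by at most [D] at [z] does not affect the paths that avoid [z] and
costs a factor [expR (- D)] on those that meet [z] once. *)
Lemma hit_ge_avoid_once V V' z N y D : 0 <= D ->
  (forall u, u != z -> V' u = V u) -> V' z <= V z + D ->
  avoid V z N y + expR (- D) * once V z N y <= hit V' N y.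
Proof.
move=> D0 VV' Vz.
have av M u : avoid V z M u <= hit V' M u.
  elim: M u => [|M IH] u /=; case: ifP => // ux; case: ifP => //= uz.
    by rewrite mulr_ge0// avg_ge0// => v; exact: hit_ge0.
  by rewrite VV' ?uz// ler_wpM2l ?expR_ge0// avg_le.
elim: N y => [|N IH] y.
  by rewrite /=; case: ifP => _; rewrite mulr0 addr0//; case: ifP.
rewrite /=; case: ifP => yx; first by rewrite mulr0 addr0.
have [yz|yz] := eqVneq y z.
  rewrite add0r mulrA -expRD; apply: ler_pM.
  - exact: expR_ge0.
  - by rewrite avg_ge0// => u; exact: avoid_ge0.
  - by rewrite ler_expR yz -opprD lerN2 addrC.
  - by rewrite avg_le.
rewrite VV'// [X in _ + X <= _]mulrCA -mulrDr ler_wpM2l ?expR_ge0//.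
by rewrite -avgZ -avgD avg_le.
Qed.

(** Replacing the potential at one site [z] raises the cost by at most
[D + ln K] times the probability, under the path measure, that [z] is
visited: paths through [z] lose at most the factor [expR (- D) / K], the
others nothing, and [- ln] is convex. *)
Lemma cost_increase V V' z N y f K D : 0 < hit V N y -> 0 <= D ->
  (forall u, u != z -> V' u = V u) -> V' z <= V z + D ->
  (forall u, 0 <= f u) -> f z = 1 -> 1 <= K ->
  (forall u, expR (- V u) * avg f u <= f u) ->
  expR (- V z) * avg f z <= 1 - K^-1 ->
  - ln (hit V' N y) <=
    - ln (hit V N y) + visit V z N y / hit V N y * (D + ln K).
Proof.
move=> e0 D0 VV' Vz f0 fz K1 fsup fz1.
have K0 : 0 < K := lt_le_trans ltr01 K1.
have lnK0 : 0 <= ln K by rewrite ln_ge0.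
set e := hit V N y in e0 *; set v := visit V z N y.
have q0 : 0 <= v / e by rewrite divr_ge0 ?visit_ge0// ltW.
have [zx|zx] := eqVneq z x.
  rewrite (@hit_local_target V' V); last by move=> u ux; rewrite VV' ?zx.
  by rewrite lerDl mulr_ge0// addr_ge0.
set o := once V z N y.
have ev : e = avoid V z N y + v by exact: hit_split.
have vo : v <= K * o by exact: visit_le_once fsup fz1.
have e'_ge : avoid V z N y + expR (- D) * o <= hit V' N y.
  exact: hit_ge_avoid_once.
set r := expR (- (D + ln K)).
have r0 : 0 < r by exact: expR_gt0.
have rE : r = expR (- D) / K by rewrite /r opprD expRD [X in _ * X]expRN lnK.
have main : e * (1 - v / e + v / e * r) <= hit V' N y.
  rewrite (le_trans _ e'_ge)// mulrDr mulrBr mulr1 mulrA mulrCA divff ?gt_eqF//.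
  rewrite mulr1 ev addrK lerD2l rE mulrCA ler_wpM2l ?expR_ge0//.
  by rewrite ler_pdivrMr// mulrC.
have q1 : v / e <= 1 by rewrite ler_pdivrMr// mul1r ev lerDr avoid_ge0.
set q := v / e in q0 q1 main *.
(* Convexity of [expR] between 0 and [ln r]. *)
have jensen : r `^ q <= 1 - q + q * r.
  have [->|q_gt0] := eqVneq q 0.
    by rewrite powRr0 mul0r subr0 addr0.
  have q_ge0 : 0 < q by rewrite lt_neqAle eq_sym q_gt0.
  have -> : r `^ q = expR (q * - (D + ln K)) by rewrite /powR gt_eqF// /r expRK.
  have := @convex_expR R (Itv01 q0 q1) (- (D + ln K)) 0.
  by rewrite !convRE /= expR0 mulr0 addr0 mulr1 [leRHS]addrC.
have : ln (e * r `^ q) <= ln (hit V' N y).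
  rewrite ler_ln ?posrE ?mulr_gt0 ?powR_gt0//.
    by rewrite (le_trans _ main)// ler_pM2l.
  by apply: lt_le_trans main; rewrite mulr_gt0// (lt_le_trans _ jensen)// powR_gt0.
rewrite lnM ?posrE ?powR_gt0// ln_powR /r expRK; lra.
Qed.

End PathSums.

(** * The number of visited sites, and a direct path *)

Section Range.
Context {R : realType} {d : nat}.
Variable x : lattice d.
Implicit Types (V : lattice d -> R) (y z : lattice d) (N : nat).

(** Path sums in which each site [u] outside [A] contributes [expR (eps - V u)] at
its first visit and 1 afterwards.  Charging first visits only makes the factors
along a path independent when the potential is. *)
Fixpoint range_weight V eps N (A : seq (lattice d)) y : R :=
  if y == x then 1
  else if N is M.+1 then
    (if y \in A then 1 else expR (eps - V y))
    * avg (range_weight V eps M (y :: A)) y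
  else 0.

Lemma range_weight_ge0 V eps N A y : 0 <= range_weight V eps N A y.
Proof.
elim: N A y => [|N IH] A y /=; case: ifP => //= _.
by rewrite mulr_ge0 ?avg_ge0//; case: ifP => // _; exact: expR_ge0.
Qed.

(** Tangent-line form, at the point [m], of Jensen's inequality for the mean of
[expR (eps * number of visited sites)] under the path measure; unlike Jensen's
inequality it is linear in the path sums, hence provable by induction on the
path length. *)
Lemma range_weight_ge V eps N (A J : seq (lattice d)) y m : uniq J ->
  0 <= eps -> (forall u, 0 <= V u) ->
  expR (eps * m) * ((1 - eps * m) * hit x V N y
    + eps * \sum_(z <- J | z \notin A) visit x V z N y)
  <= range_weight V eps N A y.
Proof.
move=> uJ eps0 V0; elim: N A y m => [|N IH] A y m.
  have [->|yx] := eqVneq y x.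
    rewrite hit_target big1 ?mulr0 ?addr0; last by move=> z _ /=; rewrite eqxx.
    rewrite mulr1 /= eqxx -[leRHS]expR0 -(subrr (eps * m)) expRD ler_wpM2l ?expR_ge0//.
    exact: expR_ge1Dx.
  rewrite hit0// big1 => [|z _]; first by rewrite !(mulr0, addr0) /= (negPf yx).
  by rewrite [visit _ _ _ _ _]/= (negPf yx) if_same.
have [->|yx] := eqVneq y x.
  rewrite hit_target big1 ?mulr0 ?addr0; last by move=> z _ /=; rewrite eqxx.
  rewrite mulr1 /= eqxx -[leRHS]expR0 -(subrr (eps * m)) expRD ler_wpM2l ?expR_ge0//.
  exact: expR_ge1Dx.
have avg_IH B k : avg (fun u => expR (eps * k) * ((1 - eps * k) * hit x V N u
    + eps * \sum_(z <- J | z \notin B) visit x V z N u)) y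
    = expR (eps * k) * ((1 - eps * k) * avg (hit x V N) y
      + eps * \sum_(z <- J | z \notin B) avg (visit x V z N) y).
  by rewrite avgZ avgD !avgZ avg_sum.
have visitS z : z != y -> visit x V z N.+1 y = expR (- V y) * avg (visit x V z N) y.
  by move=> zy; rewrite [LHS]/= (negPf yx) eq_sym (negPf zy).
rewrite [leRHS]/= (negPf yx) hitS//; case: ifP => yA.
  rewrite mul1r (eq_bigr (fun z => expR (- V y) * avg (visit x V z N) y)); last first.
    by move=> z zA; apply: visitS; apply: contraNneq zA => ->.
  have -> : \sum_(z <- J | z \notin A) expR (- V y) * avg (visit x V z N) y
      = expR (- V y) * \sum_(z <- J | z \notin y :: A) avg (visit x V z N) y.
    rewrite mulr_sumr; apply: eq_bigl => z; rewrite inE negb_or.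
    by case: eqVneq => // ->; rewrite yA.
  apply: (@le_trans _ _ (expR (- V y) * avg (range_weight V eps N (y :: A)) y)).
    rewrite [X in X + _]mulrCA [X in _ + X]mulrCA -mulrDr mulrCA ler_wpM2l ?expR_ge0//.
    by rewrite -avg_IH avg_le.
  rewrite ler_piMl ?avg_ge0//; first by move=> u; exact: range_weight_ge0.
  by rewrite expR_le1 oppr_le0.
apply: (@le_trans _ _ (expR (eps - V y) * avg (fun u => expR (eps * (m - 1))
    * ((1 - eps * (m - 1)) * hit x V N u
      + eps * \sum_(z <- J | z \notin y :: A) visit x V z N u)) y)); last first.
  by rewrite ler_wpM2l ?expR_ge0// avg_le.
rewrite avg_IH.
have -> : expR (eps - V y) * (expR (eps * (m - 1)) * ((1 - eps * (m - 1))
      * avg (hit x V N) y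
      + eps * \sum_(z <- J | z \notin y :: A) avg (visit x V z N) y))
    = expR (eps * m) * ((1 - eps * m) * (expR (- V y) * avg (hit x V N) y)
      + eps * (expR (- V y) * avg (hit x V N) y
        + \sum_(z <- J | z \notin y :: A) expR (- V y) * avg (visit x V z N) y)).
  rewrite -mulr_sumr.
  have -> : expR (eps * m) = expR eps * expR (eps * (m - 1)).
    by rewrite -expRD; congr expR; ring.
  rewrite expRD; ring.
rewrite ler_wpM2l ?expR_ge0// lerD2l.
rewrite ler_wpM2l//.
rewrite -[X in _ <= X + _]hitS//.
have vy : visit x V y N.+1 y = hit x V N.+1 y.
  by rewrite [LHS]/= (negPf yx) eqxx (hitS _ _ yx).
have [yJ|yJ] := boolP (y \in J).
  rewrite [leLHS]big_mkcond (bigD1_seq y)//= yA -/(visit x V y N.+1 y) vy.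
  rewrite lerD2l -big_mkcondr le_eqVlt; apply/orP; left; apply/eqP.
  apply: eq_big => z; first by rewrite inE negb_or.
  by case/andP => zy _; exact: visitS.
rewrite -[leLHS]add0r lerD ?hit_ge0//.
rewrite le_eqVlt; apply/orP; left; apply/eqP.
rewrite big_seq_cond [RHS]big_seq_cond; apply: eq_big => z.
  by rewrite inE; case: eqVneq => // ->; rewrite (negPf yJ).
case/andP => zJ zA; apply: visitS.
by apply: contraNneq yJ => <-.
Qed.

Lemma coordD (a b : lattice d) i :
  (a + b : 'rV[int]_d) 0 i = (a : 'rV[int]_d) 0 i + (b : 'rV[int]_d) 0 i.
Proof. by rewrite mxE. Qed.

Lemma coordB (a b : lattice d) i :
  (a - b : 'rV[int]_d) 0 i = (a : 'rV[int]_d) 0 i - (b : 'rV[int]_d) 0 i.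
Proof.
by rewrite -[LHS]/(((a : 'rV[int]_d) - (b : 'rV[int]_d)) 0 i) !mxE.
Qed.

Lemma step_coord (s : 'I_d * bool) i :
  (step s : 'rV[int]_d) 0 i = if i == s.1 then (if s.2 then 1 else -1) else 0.
Proof.
by rewrite /step; case: s.2; rewrite !mxE eqxx/=; case: ifP; rewrite ?oppr0.
Qed.

(** A step along a coordinate in which [y] and [x] differ, in the right direction. *)
Lemma dist_step y : y != x ->
  exists s, (l1norm (x - (y + step s))%R < l1norm (x - y)%R)%N.
Proof.
move=> yx; have [i xyi] : exists i, (x - y : 'rV[int]_d) 0 i != 0.
  apply/existsP; apply: contraNT yx; rewrite negb_exists => /forallP h.
  apply/eqP/rowP => i; apply/eqP; rewrite eq_sym -subr_eq0 -coordB.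
  by have := h i; rewrite negbK.
exists (i, 0 < (x - y : 'rV[int]_d) 0 i).
rewrite /l1norm (bigD1 i)//= [ltnRHS](bigD1 i)//= -addSn leq_add//.
  rewrite !coordB coordD step_coord/= eqxx; rewrite coordB in xyi.
  case: ltrP => [|]; move: xyi; lia.
rewrite leq_eqVlt; apply/orP; left; apply/eqP; apply: eq_bigr => j ji.
by rewrite !coordB coordD step_coord/= (negPf ji) addr0.
Qed.

(** The sites of the path are distinct since their distances to [x] decrease; this
is what makes their potentials independent. *)
Lemma hit_direct_path n y : l1norm (x - y) = n ->
  exists p : seq (lattice d), [/\ (size p <= n)%N, uniq p,
    forall z, z \in p -> (l1norm (x - z)%R <= n)%N &
    forall V N, (n <= N)%N ->
      (2 * d)%:R^-1 ^+ size p * expR (- \sum_(z <- p) V z) <= hit x V N y].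
Proof.
elim/ltn_ind: n y => n IH y yn.
have [->|yx] := eqVneq y x.
  exists [::]; split => // V N _.
  by rewrite hit_target big_nil oppr0 expR0 expr0 mulr1.
have [s ys] := dist_step yx; rewrite yn in ys.
have [p [sp up pdist pV]] := IH _ ys _ erefl.
exists (y :: p); split => /=.
- exact: leq_ltn_trans sp ys.
- rewrite up andbT; apply/negP => /pdist; rewrite yn leqNgt ys//.
- move=> z; rewrite inE => /predU1P[->|/pdist zn]; first by rewrite yn.
  exact: ltnW (leq_ltn_trans zn ys).
move=> V [|N] nN; first by rewrite leqn0 in nN; rewrite (eqP nN) in ys.
rewrite hitS// big_cons opprD expRD exprS.
rewrite [leLHS](_ : _ = expR (- V y) * ((2 * d)%:R^-1 *
  ((2 * d)%:R^-1 ^+ size p * expR (- \sum_(z <- p) V z)))); last ring.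
rewrite ler_wpM2l ?expR_ge0//.
apply: le_trans (avg_ge_term _ s _); last by move=> u; exact: hit_ge0.
rewrite ler_wpM2l// pV//.
by rewrite -ltnS (leq_trans ys).
Qed.

End Range.

(** * Supersolutions bounding the number of loops at a site *)

(** Existence of the supersolutions required by [cost_increase], with the same
constant [K] for all sites and all potentials that are at least [c]. *)
Definition loops_bounded {R : realType} (d : nat) (c K : R) : Prop :=
  forall (V : lattice d -> R), (forall u, c <= V u) -> forall z,
  exists f : lattice d -> R, [/\ forall u, 0 <= f u, f z = 1,
    forall u, expR (- V u) * avg f u <= f u &
    expR (- V z) * avg f z <= 1 - K^-1].

(** The constant 1 is a supersolution: at each step the walk survives with
probability at most [expR (- c)]. *)
Lemma loops_bounded_killing {R : realType} (d : nat) (c : R) : (0 < d)%N ->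
  0 < c -> exists2 K : R, 1 <= K & loops_bounded d c K.
Proof.
move=> d0 c0; have ec1 : expR (- c) < 1 by rewrite expR_lt1 oppr_lt0.
exists (1 - expR (- c))^-1.
  by rewrite invf_ge1 ?subr_gt0// gerBl expR_ge0.
move=> V Vc z; exists (fun=> 1); split => [//|//|u|].
  by rewrite avg_cst// mulr1 expR_le1 oppr_le0 (le_trans (ltW c0)).
rewrite avg_cst// mulr1 invrK opprB addrC subrK.
by rewrite ler_expR lerN2.
Qed.

Section Transience.
Context {R : realType} {d : nat}.
Implicit Types y : lattice d.

Definition decay (u : R) : R := (Num.sqrt (Num.sqrt u))^-1.

Lemma decay_gt0 u : 0 < u -> 0 < decay u.
Proof. by move=> u0; rewrite invr_gt0 !sqrtr_gt0. Qed.

Lemma decayM u v : 0 <= u -> decay (u * v) = decay u * decay v.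
Proof. by move=> u0; rewrite /decay !sqrtrM ?sqrtr_ge0// invfM. Qed.

Lemma decay_lt u v : 0 < u -> u < v -> decay v < decay u.
Proof.
move=> u0 uv; have v0 := lt_trans u0 uv.
by rewrite ltf_pV2 ?posrE ?sqrtr_gt0// !ltr_sqrt ?sqrtr_gt0.
Qed.

(** The second Taylor coefficient of [decay] at 1 is 10/64; with 11/64 the
quadratic bound survives on a neighbourhood of 0.  In terms of
[w = (1 + h) ^ (1/4)] it reads [0 <= (w - 1) ^ 2 * s(w)] for a polynomial [s]
with [s(1) = 16]. *)
Lemma decay_quadratic h : - 20^-1 <= h ->
  decay (1 + h) <= 1 - h / 4 + 11 / 64 * h ^+ 2.
Proof.
move=> h20; have h1 : 0 < 1 + h by lra.
rewrite /decay; set w := Num.sqrt _.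
have w0 : 0 < w by rewrite !sqrtr_gt0.
have w4 : w ^+ 4 = 1 + h.
  by rewrite (exprM w 2 2) sqr_sqrtr ?sqrtr_ge0// sqr_sqrtr ?ltW.
have -> : h = w ^+ 4 - 1 by rewrite w4; ring.
have w98 : 49 / 50 <= w.
  rewrite leNgt; apply/negP => wlt.
  have : w ^+ 4 <= (49 / 50) ^+ 4 by rewrite lerXn2r ?nnegrE ?ltW// divr_gt0.
  rewrite w4 => hle.
  have : (49 / 50 : R) ^+ 4 < 19 / 20 by lra.
  lra.
rewrite -(ler_pM2r w0) mulVf ?gt_eqF// -subr_ge0.
have -> : (1 - (w ^+ 4 - 1) / 4 + 11 / 64 * (w ^+ 4 - 1) ^+ 2) * w - 1 =
  (w - 1) ^+ 2 / 64 * ((((((((11 * w + 22) * w + 33) * w + 44) * w + 17) * w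
    - 10) * w - 37) * w) - 64) by field.
apply: mulr_ge0; first by rewrite mulr_ge0// sqr_ge0.
have horner a b e : a <= b -> 0 <= a -> a * (49 / 50) + e <= b * w + e.
  by move=> ab a0; rewrite lerD2r ler_pM// divr_ge0.
have h1' : (32 : R) <= 11 * w + 22 by lra.
have h2 : (64 : R) <= (11 * w + 22) * w + 33 by have := horner _ _ 33 h1' ltac:(lra); lra.
have h3 : (106 : R) <= ((11 * w + 22) * w + 33) * w + 44.
  by have := horner _ _ 44 h2 ltac:(lra); lra.
have h4 : (120 : R) <= (((11 * w + 22) * w + 33) * w + 44) * w + 17.
  by have := horner _ _ 17 h3 ltac:(lra); lra.
have h5 : (107 : R) <= ((((11 * w + 22) * w + 33) * w + 44) * w + 17) * w - 10.
  by have := horner _ _ (-10) h4 ltac:(lra); lra.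
have h6 : (67 : R) <= (((((11 * w + 22) * w + 33) * w + 44) * w + 17) * w - 10) * w - 37.
  by have := horner _ _ (-37) h5 ltac:(lra); lra.
by have := horner _ _ (-64) h6 ltac:(lra); lra.
Qed.

Let coord y (i : 'I_d) : R := ((y : 'rV[int]_d) 0 i)%:~R.

Definition sqnorm y : R := \sum_(i < d) coord y i ^+ 2.

Lemma sqnorm_ge0 y : 0 <= sqnorm y.
Proof. by apply: sumr_ge0 => i _; exact: sqr_ge0. Qed.

Lemma sqnorm_step y s :
  sqnorm (y + step s) = sqnorm y + 1 + (if s.2 then 2 else -2) * coord y s.1.
Proof.
rewrite /sqnorm (bigD1 s.1)//= [in RHS](bigD1 s.1)//=.
rewrite (eq_bigr (fun i => coord y i ^+ 2)); last first.
  by move=> i si; rewrite /coord coordD step_coord (negPf si) addr0.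
rewrite /coord coordD step_coord eqxx rmorphD/=.
by case: s.2; rewrite ?rmorphN/= rmorph1; ring.
Qed.

(** The summand 400 keeps the relative change of [base + sqnorm y] under one step
above [- 1 / 20], as [decay_quadratic] requires; [d] absorbs the second-order
terms that do not depend on [y]. *)
Definition base : R := 400 + d%:R.

Lemma base_gt0 : 0 < base. Proof. by have := ler0n R d; rewrite /base; lra. Qed.

(** This is what makes the walk transient.  Put [u = base + sqnorm y].  In units of
[decay u / u], the first-order terms of the increments sum up to [- d / 2] and the
second-order ones to at most [8 * 11 / 64] up to lower order, which is smaller in
absolute value as soon as [d] is at least 3. *)
Lemma decay_superharmonic y : (3 <= d)%N ->
  avg (fun u => decay (base + sqnorm u)) y <= decay (base + sqnorm y).
Proof.
move=> d3; set u := base + sqnorm y.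
have d3R : 3 <= d%:R :> R by rewrite ler_nat.
have u0 : 0 < u by rewrite ltr_wpDr ?sqnorm_ge0 ?base_gt0.
pose h (s : 'I_d * bool) : R := (1 + (if s.2 then 2 else -2) * coord y s.1) / u.
have uh s : base + sqnorm (y + step s) = u * (1 + h s).
  rewrite sqnorm_step /h mulrDr mulr1 [u * _]mulrCA divff ?gt_eqF// mulr1 /u; ring.
have h20 s : - 20^-1 <= h s.
  rewrite /h ler_pdivlMr//.
  have : coord y s.1 ^+ 2 <= sqnorm y.
    by rewrite /sqnorm (bigD1 s.1)//= lerDl sumr_ge0// => i _; exact: sqr_ge0.
  have : 0 <= d%:R :> R by [].
  have := sqr_ge0 (coord y s.1 - 20); have := sqr_ge0 (coord y s.1 + 20).
  by rewrite /u /base; case: s.2; nra.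
have dec s : decay (base + sqnorm (y + step s))
    <= decay u * (1 - h s / 4 + 11 / 64 * h s ^+ 2).
  by rewrite uh (decayM _ (ltW u0)) ler_pM2l ?decay_gt0// decay_quadratic.
rewrite /avg; apply: (@le_trans _ _ ((2 * d)%:R^-1 *
    \sum_s decay u * (1 - h s / 4 + 11 / 64 * h s ^+ 2))).
  by rewrite ler_wpM2l// ler_sum.
have dd0 : 0 < (2 * d)%:R :> R by rewrite ltr0n muln_gt0/=; apply: leq_trans d3.
rewrite ler_pdivrMl// -mulr_sumr mulrC ler_pM2r ?decay_gt0//.
have -> : \sum_s (1 - h s / 4 + 11 / 64 * h s ^+ 2) = \sum_(i < d)
    (2 - (2 * u)^-1 + 11 / 32 / u ^+ 2 + 11 / 8 / u ^+ 2 * coord y i ^+ 2).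
  rewrite -(pair_bigA _ (fun i b => 1 - h (i, b) / 4 + 11 / 64 * h (i, b) ^+ 2)).
  apply: eq_bigr => i _; rewrite big_bool /h/=; field.
  by rewrite gt_eqF.
rewrite big_split /= -mulr_sumr sumr_const card_ord -/(sqnorm y) -[_ *+ d]mulr_natr natrM.
rewrite -(ler_pM2r (exprn_gt0 2 u0)).
have -> : ((2 - (2 * u)^-1 + 11 / 32 / u ^+ 2) * d%:R
    + 11 / 8 / u ^+ 2 * sqnorm y) * u ^+ 2 =
  2 * d%:R * u ^+ 2 - u * d%:R / 2 + 11 / 32 * d%:R + 11 / 8 * sqnorm y.
  by field; rewrite gt_eqF.
have := sqnorm_ge0 y; have -> : sqnorm y = u - base by rewrite /u; ring.
rewrite subr_ge0 /base => bu; nra.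
Qed.

(** The supersolution is [decay (base + sqnorm (u - z))], normalised at [z], where
it has a strict maximum; so the mean of its values at the neighbours of [z] is
less than 1, and [K] is the inverse of the gap. *)
Lemma loops_bounded_transience : (3 <= d)%N ->
  exists2 K : R, 1 <= K & loops_bounded d 0 K.
Proof.
move=> d3; have d0 : (0 < d)%N by apply: leq_trans d3.
pose f y := decay (base + sqnorm y) / decay base.
have db0 : 0 < decay base by rewrite decay_gt0 ?base_gt0.
have dbV0 : 0 < (decay base)^-1 by rewrite invr_gt0.
have sqnorm0 : sqnorm 0 = 0.
  by apply: big1 => i _; rewrite /coord -[X in X%:~R]/((0 : 'rV[int]_d) 0 i) mxE expr0n.
have f0 y : 0 < f y.
  by rewrite divr_gt0// decay_gt0// ltr_wpDr ?sqnorm_ge0 ?base_gt0.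
have f00 : f 0 = 1 by rewrite /f sqnorm0 addr0 divff// gt_eqF.
have fsup y : avg f y <= f y.
  rewrite /f.
  have -> : avg (fun u => decay (base + sqnorm u) / decay base) y =
      avg (fun u => decay (base + sqnorm u)) y / decay base.
    by rewrite mulrC -avgZ /avg; congr (_ * _); apply: eq_bigr => s _; rewrite mulrC.
  by rewrite (ler_pM2r dbV0) decay_superharmonic.
set a := avg f 0.
have a0 : 0 < a.
  rewrite /a /avg mulr_gt0// ?invr_gt0 ?ltr0n ?muln_gt0//.
  rewrite (bigD1 (Ordinal d0, true))//= ltr_wpDr// sumr_ge0// => s _.
  exact: ltW.
have a1 : a < 1.
  rewrite /a -[ltRHS](avg_cst d0 1 (0 : lattice d)) /avg ltr_pM2l; last first.
    by rewrite invr_gt0 ltr0n muln_gt0.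
  apply: ltr_sum => [|s _].
    by apply/hasP; exists (Ordinal d0, true); rewrite // mem_index_enum.
    rewrite /f sqnorm_step sqnorm0 /coord.
    rewrite -[X in X%:~R]/((0 : 'rV[int]_d) 0 s.1) mxE mulr0 addr0 add0r.
    by rewrite ltr_pdivrMr// mul1r decay_lt ?base_gt0// ltrDl.
exists (1 - a)^-1.
  by rewrite invf_ge1 ?subr_gt0// gerBl ltW.
move=> V V0 z; exists (fun y => f (y - z)).
have avgT y : avg (fun y => f (y - z)) y = avg f (y - z).
  by rewrite /avg; congr (_ * _); apply: eq_bigr => s _; rewrite addrAC.
have eV u : expR (- V u) <= 1 by rewrite expR_le1 oppr_le0.
have afge0 u : 0 <= avg f u by apply: avg_ge0 => v; exact: ltW.
split => [u||u|]; first exact: ltW.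
- by rewrite subrr.
- by rewrite avgT (le_trans _ (fsup _))// ler_piMl.
- by rewrite avgT subrr invrK opprB addrC subrK ler_piMl.
Qed.

End Transience.

(** * Means of bounded random variables *)

Notation mean P f := (Rintegral P setT f).

Section Bounded.
Context {R : realType} {dT : measure_display} {T : measurableType dT}.
Implicit Types (P : probability T R) (f g : T -> R).

Definition bounded_rv f : Prop :=
  measurable_fun setT f /\ exists M, forall x, `|f x| <= M.

Lemma bounded_rv_integrable P f : bounded_rv f -> P.-integrable setT (EFin \o f).
Proof.
move=> [mf [M fM]]; apply: measurable_bounded_integrable => //.
  by rewrite (le_lt_trans (probability_le1 _ _))// ltry.
by exists M; split; [exact: num_real|move=> N MN x _; exact: le_trans (fM x) (ltW MN)].
Qed.

Lemma bounded_rv_cst c : bounded_rv (fun=> c).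
Proof. by split; [exact: measurable_cst|exists `|c|]. Qed.

Lemma bounded_rvD f g : bounded_rv f -> bounded_rv g ->
  bounded_rv (fun x => f x + g x).
Proof.
move=> [mf [M fM]] [mg [N gN]]; split; first exact: measurable_funD.
by exists (M + N) => x; rewrite (le_trans (ler_normD _ _))// lerD.
Qed.

Lemma bounded_rvM f g : bounded_rv f -> bounded_rv g ->
  bounded_rv (fun x => f x * g x).
Proof.
move=> [mf [M fM]] [mg [N gN]]; split; first exact: measurable_funM.
by exists (M * N) => x; rewrite normrM ler_pM.
Qed.

Lemma bounded_rvB f g : bounded_rv f -> bounded_rv g ->
  bounded_rv (fun x => f x - g x).
Proof.
move=> [mf [M fM]] [mg [N gN]]; split; first exact: measurable_funB.
by exists (M + N) => x; rewrite (le_trans (ler_normB _ _))// lerD.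
Qed.

Lemma bounded_rvX f n : bounded_rv f -> bounded_rv (fun x => f x ^+ n).
Proof.
move=> [mf [M fM]]; split; first exact: measurable_funX.
by exists (M ^+ n) => x; rewrite normrX lerXn2r// nnegrE (le_trans _ (fM x)).
Qed.

Lemma bounded_rv_max f g : bounded_rv f -> bounded_rv g ->
  bounded_rv (fun x => Num.max (f x) (g x)).
Proof.
move=> [mf [M fM]] [mg [N gN]]; split; first exact: measurable_maxr.
exists (Num.max M N) => x; case: (leP (f x) (g x)) => _.
  by rewrite le_max gN orbT.
by rewrite le_max fM.
Qed.

Lemma meanD P f g : bounded_rv f -> bounded_rv g ->
  mean P (fun x => f x + g x) = mean P f + mean P g.
Proof. by move=> bf bg; rewrite RintegralD//; exact: bounded_rv_integrable. Qed.

Lemma meanB P f g : bounded_rv f -> bounded_rv g ->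
  mean P (fun x => f x - g x) = mean P f - mean P g.
Proof. by move=> bf bg; rewrite RintegralB//; exact: bounded_rv_integrable. Qed.

Lemma meanZ P c f : bounded_rv f -> mean P (fun x => c * f x) = c * mean P f.
Proof. by move=> bf; rewrite RintegralZl//; exact: bounded_rv_integrable. Qed.

Lemma mean_cst P c : mean P (fun=> c) = c.
Proof. by rewrite Rintegral_cst// [X in fine X](probability_setT P) mulr1. Qed.

Lemma le_mean P f g : bounded_rv f -> bounded_rv g ->
  (forall x, f x <= g x) -> mean P f <= mean P g.
Proof.
by move=> bf bg fg; apply: le_Rintegral => //; exact: bounded_rv_integrable.
Qed.

Lemma eq_mean P f g : f =1 g -> mean P f = mean P g.
Proof. by move=> fg; apply: eq_Rintegral => x _. Qed.

Lemma mean_bound P f M : (forall x, `|f x| <= M) -> measurable_fun setT f ->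
  `|mean P f| <= M.
Proof.
move=> fM mf; have bf : bounded_rv f by split => //; exists M.
rewrite ler_norml -[leLHS](mean_cst P) -[X in _ && (_ <= X)](mean_cst P).
by rewrite !le_mean//; try (exact: bounded_rv_cst); move=> x;
  have := fM x; rewrite ler_norml => /andP[].
Qed.

Lemma mean_sqr_ge P f : bounded_rv f -> mean P f ^+ 2 <= mean P (fun x => f x ^+ 2).
Proof.
move=> bf; set m := mean P f.
have bf2 := bounded_rvX 2 bf.
have : 0 <= mean P (fun x => (f x - m) ^+ 2).
  by apply: Rintegral_ge0 => x _; exact: sqr_ge0.
rewrite (@eq_mean _ _ (fun x => (f x ^+ 2 - (2 * m) * f x) + m ^+ 2)); last first.
  by move=> x; ring.
have bmf : bounded_rv (fun x => 2 * m * f x).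
  by apply: bounded_rvM => //; exact: bounded_rv_cst.
rewrite (meanD _ (bounded_rvB bf2 bmf) (bounded_rv_cst _)) (meanB _ bf2 bmf).
rewrite (meanZ _ _ bf) mean_cst -/m; nra.
Qed.

(** By symmetry only the increases of a variable under resampling matter in the
Efron-Stein inequality, whence the positive part. *)
Definition pos_sqr (t : R) : R := Num.max t 0 ^+ 2.

Lemma pos_sqr_ge0 t : 0 <= pos_sqr t. Proof. exact: sqr_ge0. Qed.

Lemma pos_sqrD t : pos_sqr t + pos_sqr (- t) = t ^+ 2.
Proof.
rewrite /pos_sqr; case: (leP t 0) => t0.
  by rewrite max_l ?oppr_ge0// expr0n add0r sqrrN.
by rewrite max_r ?oppr_le0 ?ltW// expr0n addr0.
Qed.

Lemma pos_sqr_homo s t : s <= t -> pos_sqr s <= pos_sqr t.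
Proof.
move=> st; have max_ge0 r : 0 <= Num.max r 0 :> R by rewrite le_max lexx orbT.
by rewrite /pos_sqr lerXn2r ?nnegrE// ge_max max_ge0 le_max st.
Qed.

Lemma bounded_rv_pos_sqr f : bounded_rv f -> bounded_rv (fun x => pos_sqr (f x)).
Proof. by move=> bf; apply/bounded_rvX/bounded_rv_max => //; exact: bounded_rv_cst. Qed.

Lemma pos_sqr_mean P f : bounded_rv f ->
  pos_sqr (mean P f) <= mean P (fun x => pos_sqr (f x)).
Proof.
move=> bf; have b0 := bounded_rv_cst 0.
have bm : bounded_rv (fun x => Num.max (f x) 0) by exact: bounded_rv_max.
have max_ge0 r : 0 <= Num.max r 0 :> R by rewrite le_max lexx orbT.
have mean_ge0 : 0 <= mean P (fun x => Num.max (f x) 0) by exact: Rintegral_ge0.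
apply: le_trans (mean_sqr_ge P bm); rewrite lerXn2r ?nnegrE//.
by rewrite ge_max mean_ge0 andbT le_mean// => x; rewrite le_max lexx.
Qed.

End Bounded.

Section Fubini.
Context {R : realType} {d1 d2 : measure_display}.
Context {T1 : measurableType d1} {T2 : measurableType d2}.
Variables (P1 : probability T1 R) (P2 : probability T2 R).
Implicit Types f : T1 -> T2 -> R.

Lemma bounded_rv_pair1 f y : bounded_rv (fun z => f z.1 z.2) ->
  bounded_rv (fun x => f x y).
Proof.
move=> [mf [M fM]]; split; last by exists M => x; exact: (fM (x, y)).
exact: (measurableT_comp mf (measurable_fun_pair (@measurable_id _ T1 setT) (measurable_cst y))).
Qed.

Lemma bounded_rv_pair2 f x : bounded_rv (fun z => f z.1 z.2) -> bounded_rv (f x).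
Proof.
move=> [mf [M fM]]; split; last by exists M => y; exact: (fM (x, y)).
exact: (measurableT_comp mf (measurable_fun_pair (measurable_cst x) (@measurable_id _ T2 setT))).
Qed.

Lemma bounded_rv_mean f : bounded_rv (fun z => f z.1 z.2) ->
  bounded_rv (fun x => mean P2 (f x)).
Proof.
move=> bf; split; last first.
  have [mf [M fM]] := bf; exists M => x; apply: mean_bound.
    by move=> y; exact: (fM (x, y)).
  by have [] := bounded_rv_pair2 x bf.
apply: (measurableT_comp (fine_measurable measurableT)).
have := measurable_fubini_F (bounded_rv_integrable (P1 \x P2)%E bf).
exact.
Qed.

Lemma mean_Fubini f : bounded_rv (fun z => f z.1 z.2) ->
  mean P1 (fun x => mean P2 (f x)) = mean P2 (fun y => mean P1 (fun x => f x y)).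
Proof.
move=> bf; rewrite /Rintegral.
transitivity (fine (\int[P1]_x \int[P2]_y (f x y)%:E)%E).
  congr fine; apply: eq_integral => x _; rewrite fineK//.
  exact: (integrable_fin_num measurableT (bounded_rv_integrable P2 (bounded_rv_pair2 x bf))).
rewrite (Fubini (bounded_rv_integrable (P1 \x P2)%E bf)).
congr fine; apply: eq_integral => y _; rewrite fineK//.
exact: (integrable_fin_num measurableT (bounded_rv_integrable P1 (bounded_rv_pair1 y bf))).
Qed.

End Fubini.

(** * Resampling one site of the potential *)

Section Resampling.
Context {R : realType} {d : nat}.
Implicit Types (w : potential R d) (z y : lattice d).

Definition resample z w w' : potential R d :=
  (fun y => if y == z then (w' : raw_potential R d) y
            else (w : raw_potential R d) y) : raw_potential R d.

Lemma site_resample z w w' y :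
  site y (resample z w w') = if y == z then site y w' else site y w.
Proof. by rewrite /site /resample; case: ifP. Qed.

Lemma potential_eq w w' : (forall y, site y w = site y w') -> w = w'.
Proof. by move=> ww'; apply/funext => y; apply/eqP; rewrite -num_eq; apply/eqP/ww'. Qed.

Lemma resample_resample z w w' w'' :
  resample z (resample z w w') w'' = resample z w w''.
Proof. by apply: potential_eq => y; rewrite !site_resample; case: eqVneq. Qed.

Lemma resampleC z y w w' w'' : y != z ->
  resample y (resample z w w') w'' = resample z (resample y w w'') w'.
Proof.
move=> yz; apply: potential_eq => u; rewrite !site_resample.
by case: eqVneq => // ->; rewrite (negPf yz).
Qed.

Lemma measurable_resample z :
  measurable_fun setT (fun p : potential R d * potential R d => resample z p.1 p.2).
Proof.
apply: (measurability (@cylinders R d : set (set (potential R d)))) => // _ [_ [x [B [mB ->]]] <-].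
rewrite setTI.
have -> : (fun p : potential R d * potential R d => resample z p.1 p.2) @^-1`
    [set w | B (site x w)]
  = (if x == z then (site x \o snd) else (site x \o fst)) @^-1` B.
  by apply/seteqP; split => p /=; rewrite site_resample; case: ifP.
rewrite -[X in measurable X]setTI; case: ifP => _.
  exact: (measurableT_comp (measurable_site x) measurable_snd).
exact: (measurableT_comp (measurable_site x) measurable_fst).
Qed.

Lemma measurable_fun_resample dT (T : measurableType dT) z
    (a b : T -> potential R d) : measurable_fun setT a -> measurable_fun setT b ->
  measurable_fun setT (fun x => resample z (a x) (b x)).
Proof.
move=> ma mb.
exact: (measurableT_comp (measurable_resample z) (measurable_fun_pair ma mb)).
Qed.

Variable P : probability (potential R d) R.
Hypothesis indep : mutually_independent P (@site R d).

(** Replacing one coordinate by an independent copy does not change the law of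
the potential; every use of independence goes through this identity. *)
Lemma law_resample z A : measurable A ->
  pushforward (P \x P)%E (fun p => resample z p.1 p.2) A = P A.
Proof.
(* Finite-dimensional rectangles form a generating pi-system. *)
pose rect (J : seq (lattice d)) (B : lattice d -> set R) : set (potential R d) :=
  \bigcap_(i in [set` J]) (site i @^-1` B i).
pose G := [set A | exists (J : seq (lattice d)) (B : lattice d -> set R),
  [/\ uniq J, forall i, measurable (B i) & A = rect J B]].
have mrect J B : (forall i, measurable (B i)) -> measurable (rect J B).
  move=> mB; apply: fin_bigcap_measurable => [|i _]; first exact: finite_seq.
  by rewrite -[X in measurable X]setTI; exact: measurable_site.
apply: (measure_unique G (fun=> setT)).
- apply/seteqP; split.
    apply: smallest_sub; first exact: smallest_sigma_algebra.
    move=> _ [x [B [mB ->]]]; apply: sub_gen_smallest.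
    exists [:: x], (fun=> B); split => //; apply/seteqP; split => w /=.
      by move=> Bx i /=; rewrite inE => /eqP ->.
    by move=> /(_ x); apply; rewrite /= inE.
  apply: smallest_sub; first exact: sigma_algebra_measurable.
  by move=> _ [J [B [uJ mB ->]]]; exact: mrect.
- move=> _ _ [J [B [uJ mB ->]]] [J' [B' [uJ' mB' ->]]].
  exists (undup (J ++ J')), (fun i =>
    (if i \in J then B i else setT) `&` (if i \in J' then B' i else setT)).
  split; first exact: undup_uniq.
    by move=> i; apply: measurableI; case: ifP.
  apply/seteqP; split => w.
    move=> [h h'] i _ /=; split; case: ifP => // iJ; [exact: h|exact: h'].
  move=> h; split => i /= iJ; have /h : i \in undup (J ++ J')
    by rewrite mem_undup mem_cat iJ ?orbT.
    by move=> [+ _]; rewrite iJ.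
  by move=> [_ +]; rewrite iJ.
- move=> _; exists [::], (fun=> setT); split => //.
  by apply/seteqP; split => // w _ i.
- by rewrite bigcup_const//; exists 0%N.
- exact: measurable_resample.
- move=> mr _ [J [B [uJ mB ->]]].
  pose J' := [seq i <- J | i != z].
  rewrite [LHS](_ : _ =
      (P \x P)%E (rect J' B `*` (if z \in J then site z @^-1` B z else setT))); last first.
    congr ((P \x P)%E _); apply/seteqP; split => -[w w'].
      move=> h; split => /=.
        move=> i /=; rewrite mem_filter => /andP[iz iJ].
        by have := h i iJ; rewrite /= site_resample (negPf iz).
      by case: ifP => // zJ; have := h z zJ; rewrite /= site_resample eqxx.
    move=> [/= h h'] i /= iJ; rewrite site_resample; case: eqVneq => [iz|iz].
      by move: h'; rewrite -iz iJ.
    by apply: h; rewrite /= mem_filter iz.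
  have Prect K : uniq K -> P (rect K B) = (\prod_(i <- K) P (site i @^-1` B i))%E.
    by move=> uK; exact: indep.
  transitivity (P (rect J' B) * P (if z \in J then site z @^-1` B z else setT))%E.
    apply: product_measure1E; first exact: mrect.
    case: ifP => // _; rewrite -[X in measurable X]setTI; exact: measurable_site.
  rewrite [RHS](Prect J uJ) Prect ?filter_uniq// big_filter.
  case: ifP => zJ; last first.
    rewrite probability_setT mule1 big_seq_cond [RHS]big_seq_cond.
    apply: eq_bigl => i; rewrite /= andbT andbC.
    by case: eqVneq => // ->; rewrite zJ.
  by rewrite (bigD1_seq z)//= muleC.
- move=> mr _; rewrite [X in (X < _)%E](_ : _ = 1%E) ?ltry//.
  exact: (probability_setT (P \x P)%E).
Qed.

Lemma integral_resample z (f : potential R d -> \bar R) : measurable_fun setT f ->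
  (forall w, (0 <= f w)%E) ->
  (\int[P]_w f w = \int[P]_w \int[P]_w' f (resample z w w'))%E.
Proof.
move=> mf f0; have mr := measurable_resample z.
rewrite -(@eq_measure_integral _ _ _ setT P
  (pushforward (P \x P)%E (fun p => resample z p.1 p.2))); last first.
  by move=> A mA _; exact: law_resample.
rewrite ge0_integral_pushforward//= preimage_setT.
rewrite (fubini_tonelli1 (fun p => f (resample z p.1 p.2)))//.
exact: measurableT_comp.
Qed.

(** Resampling [z] decouples [f], which depends on [z] only, from [g]. *)
Lemma integral_siteM z (f g : potential R d -> \bar R) :
  measurable_fun setT f -> measurable_fun setT g ->
  (forall w, (0 <= f w)%E) -> (forall w, (0 <= g w)%E) ->
  (forall w w', site z w = site z w' -> f w = f w') ->
  (forall w w', g (resample z w w') = g w) ->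
  (\int[P]_w (f w * g w) = \int[P]_w f w * \int[P]_w g w)%E.
Proof.
move=> mf mg f0 g0 fz gz.
rewrite (@integral_resample z); [|exact: emeasurable_funM|by move=> w; exact: mule_ge0].
transitivity (\int[P]_w (\int[P]_w' f w' * g w))%E; last first.
  by rewrite ge0_integralZl//; exact: integral_ge0.
apply: eq_integral => w _.
transitivity (\int[P]_w' (f w' * g w))%E; last by rewrite ge0_integralZr.
apply: eq_integral => w' _; rewrite gz; congr (_ * _)%E; apply: fz.
by rewrite site_resample eqxx.
Qed.

(** * The Efron-Stein inequality *)

Implicit Types f : potential R d -> R.

Lemma bounded_rv_resample z f : bounded_rv f ->
  bounded_rv (fun p : potential R d * potential R d => f (resample z p.1 p.2)).
Proof.
move=> [mf [M fM]]; split; last by exists M.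
exact: (measurableT_comp mf (measurable_resample z)).
Qed.

Lemma bounded_rv_resample_at z w f : bounded_rv f ->
  bounded_rv (fun w' => f (resample z w w')).
Proof.
move=> bf.
exact: (bounded_rv_pair2 (f := fun w w' => f (resample z w w')) w (bounded_rv_resample z bf)).
Qed.

(** The conditional expectation of [f] given all sites but [z]. *)
Definition average_site z f w : R :=
  mean P (fun w' => f (resample z w w')).

Lemma bounded_rv_average_site z f : bounded_rv f -> bounded_rv (average_site z f).
Proof.
move=> bf; apply: (bounded_rv_mean P P (f := fun w w' => f (resample z w w'))).
exact: bounded_rv_resample.
Qed.

Lemma mean_average_site z f : bounded_rv f -> mean P (average_site z f) = mean P f.
Proof.
move=> bf; have [mf [M fM]] := bf.
have bM : bounded_rv (fun _ : potential R d => M) by exact: bounded_rv_cst.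
have bfM : bounded_rv (fun w => f w + M) by exact: bounded_rvD.
have fM0 w : 0 <= f w + M.
  by have := fM w; rewrite ler_norml => /andP[+ _]; rewrite -subr_ge0 opprK.
have shift : mean P (average_site z (fun w => f w + M)) = mean P (fun w => f w + M).
  rewrite {2}/Rintegral (@integral_resample z); first last.
  - by move=> w; rewrite lee_fin.
  - by apply/measurable_EFinP; case: bfM.
  rewrite {1}/Rintegral; congr fine; apply: eq_integral => w _.
  rewrite /average_site /Rintegral fineK//.
  exact: (integrable_fin_num measurableT (bounded_rv_integrable P
    (bounded_rv_resample_at z w bfM))).
move: shift; rewrite (meanD _ bf bM) mean_cst.
rewrite [X in X = _](_ : _ = mean P (fun w => average_site z f w + M)); last first.
  apply: eq_mean.
  by move=> w; rewrite /average_site (meanD _ (bounded_rv_resample_at z w bf) bM) mean_cst.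
by rewrite (meanD _ (bounded_rv_average_site z bf) bM) mean_cst => /addIr.
Qed.

Definition influence z f : R :=
  mean P (fun w => mean P (fun w' => pos_sqr (f (resample z w w') - f w))).

Lemma bounded_rv_increase z f : bounded_rv f ->
  bounded_rv (fun p : potential R d * potential R d =>
    pos_sqr (f (resample z p.1 p.2) - f p.1)).
Proof.
move=> bf; apply/bounded_rv_pos_sqr/bounded_rvB; first exact: bounded_rv_resample.
have [mf [M fM]] := bf; split; last by exists M.
exact: (measurableT_comp mf measurable_fst).
Qed.

(** The mean squared difference of two independent copies is twice the variance,
and increases and decreases contribute equally. *)
Lemma mean_pair_pos_sqr f : bounded_rv f ->
  mean P (fun w => mean P (fun w' => pos_sqr (f w' - f w))) =
  mean P (fun w => f w ^+ 2) - mean P f ^+ 2.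
Proof.
move=> bf; have [mf [M fM]] := bf.
have b1 : bounded_rv (fun p : potential R d * potential R d => f p.1).
  by split; [exact: (measurableT_comp mf measurable_fst)|exists M].
have b2 : bounded_rv (fun p : potential R d * potential R d => f p.2).
  by split; [exact: (measurableT_comp mf measurable_snd)|exists M].
pose D := mean P (fun w => mean P (fun w' => pos_sqr (f w' - f w))).
have bD : bounded_rv (fun p : potential R d * potential R d => pos_sqr (f p.2 - f p.1)).
  exact/bounded_rv_pos_sqr/bounded_rvB.
have bD' : bounded_rv (fun p : potential R d * potential R d => pos_sqr (- (f p.2 - f p.1))).
  apply/bounded_rv_pos_sqr; under eq_fun do rewrite opprB; exact: bounded_rvB.
have sym : D = mean P (fun w => mean P (fun w' => pos_sqr (- (f w' - f w)))).
  rewrite /D (mean_Fubini P P (f := fun w w' => pos_sqr (f w' - f w)) bD).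
  by apply: eq_mean => w; apply: eq_mean => w'; rewrite opprB.
have bf2 := bounded_rvX 2 bf.
have DD : D + D = mean P (fun w => mean P (fun w' => (f w' - f w) ^+ 2)).
  rewrite {2}sym /D -meanD; first last.
  - exact: (bounded_rv_mean P P (f := fun w w' => pos_sqr (- (f w' - f w)))).
  - exact: (bounded_rv_mean P P (f := fun w w' => pos_sqr (f w' - f w))).
  apply: eq_mean => w; rewrite -meanD; first last.
  - exact: (bounded_rv_pair2 (f := fun w w' => pos_sqr (- (f w' - f w)))).
  - exact: (bounded_rv_pair2 (f := fun w w' => pos_sqr (f w' - f w))).
  by apply: eq_mean => w'; exact: pos_sqrD.
have : D + D = 2 * (mean P (fun w => f w ^+ 2) - mean P f ^+ 2).
  rewrite DD; set m2 := mean P (fun w => f w ^+ 2); set m := mean P f.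
  rewrite (@eq_mean _ _ _ _ _ (fun w => (m2 + f w ^+ 2) - (2 * m) * f w)).
    have bA : bounded_rv (fun w => m2 + f w ^+ 2).
      exact: (bounded_rvD (bounded_rv_cst _) bf2).
    have bB : bounded_rv (fun w => 2 * m * f w).
      exact: (bounded_rvM (bounded_rv_cst _) bf).
    rewrite (meanB _ bA bB) (meanD _ (bounded_rv_cst _) bf2) mean_cst (meanZ _ _ bf) -/m -/m2; ring.
  move=> w; rewrite (@eq_mean _ _ _ _ _ (fun w' => (f w' ^+ 2 + f w ^+ 2)
    - (2 * f w) * f w')); last by move=> w'; ring.
  have bA : bounded_rv (fun w' => f w' ^+ 2 + f w ^+ 2).
    exact: (bounded_rvD bf2 (bounded_rv_cst _)).
  have bB : bounded_rv (fun w' => 2 * f w * f w').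
    exact: (bounded_rvM (bounded_rv_cst _) bf).
  rewrite (meanB _ bA bB) (meanD _ bf2 (bounded_rv_cst _)) mean_cst (meanZ _ _ bf) -/m -/m2; ring.
rewrite -/D => h; apply: (@mulfI _ (2 : R)); first by rewrite pnatr_eq0.
by rewrite -h mulrDl mul1r.
Qed.

Lemma influenceE z f : bounded_rv f ->
  influence z f = mean P (fun w => f w ^+ 2) - mean P (fun w => average_site z f w ^+ 2).
Proof.
move=> bf; rewrite /influence.
have binc := bounded_rv_increase z bf.
rewrite -(mean_average_site z); last first.
  exact: (bounded_rv_mean P P (f := fun w w' => pos_sqr (f (resample z w w') - f w))).
rewrite -(mean_average_site z (bounded_rvX 2 bf)).
rewrite -meanB; [|exact/bounded_rv_average_site/bounded_rvX
                 |exact/bounded_rvX/bounded_rv_average_site].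
apply: eq_mean => w; rewrite {1 2}/average_site.
have bw := bounded_rv_resample_at z w bf.
rewrite -(mean_pair_pos_sqr bw); apply: eq_mean => w'; apply: eq_mean => w''.
by rewrite resample_resample.
Qed.

(** Jensen's inequality for the average over the site [y], which is resampled
independently of [z]. *)
Lemma influence_average_site z y f : y != z -> bounded_rv f ->
  influence z (average_site y f) <= influence z f.
Proof.
move=> yz bf; rewrite /influence.
have binc g : bounded_rv g -> bounded_rv (fun w => mean P (fun w' => pos_sqr (g (resample z w w') - g w))).
  move=> bg; apply: (bounded_rv_mean P P
    (f := fun w w' => pos_sqr (g (resample z w w') - g w))).
  exact: bounded_rv_increase.
rewrite -[leRHS](mean_average_site y (binc _ bf)).
apply: le_mean; [exact/binc/bounded_rv_average_site|exact/bounded_rv_average_site/binc|].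
move=> w; rewrite /average_site.
have by2 u := bounded_rv_resample_at y u bf.
have b3 : bounded_rv (fun p : potential R d * potential R d =>
    f (resample z (resample y w p.1) p.2) - f (resample y w p.1)).
  have [mf [M fM]] := bf.
  have m1 : measurable_fun setT (fun p : potential R d * potential R d =>
      resample y w p.1).
    by apply: measurable_fun_resample; [exact: measurable_cst|exact: measurable_fst].
  apply: bounded_rvB; split; try by exists M.
    exact: (measurableT_comp mf (measurable_fun_resample z m1 measurable_snd)).
  exact: (measurableT_comp mf m1).
pose h w'' w' := f (resample z (resample y w w'') w') - f (resample y w w'').
have bh : bounded_rv (fun p => pos_sqr (h p.1 p.2)) by exact: bounded_rv_pos_sqr.
rewrite (mean_Fubini P P (f := fun w'' w' => pos_sqr (h w'' w')) bh).
apply: le_mean.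
- apply/bounded_rv_pos_sqr/bounded_rvB; last exact: bounded_rv_cst.
  apply: (bounded_rv_mean P P (f := fun w' w'' => f (resample y (resample z w w') w''))).
  have [mf [M fM]] := bf; split; last by exists M.
  apply: (measurableT_comp mf); apply: measurable_fun_resample; last exact: measurable_snd.
  by apply: measurable_fun_resample; [exact: measurable_cst|exact: measurable_fst].
- apply: (bounded_rv_mean P P (f := fun w' w'' => pos_sqr (h w'' w'))).
  have [mh [M hM]] := bh; split; last by exists M => p; exact: (hM (p.2, p.1)).
  exact: (measurableT_comp mh (measurable_fun_pair measurable_snd measurable_fst)).
- move=> w'; rewrite -meanB; [|exact: by2|exact: by2].
  rewrite (@eq_mean _ _ _ _ _ (h ^~ w')).
    by apply: pos_sqr_mean; exact: (bounded_rv_pair1 w' b3).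
  by move=> w''; rewrite resampleC.
Qed.

(** Averaging out the sites one at a time splits the variance into the
contributions of the sites; averaging the other sites first does not increase
the influence of a site, by convexity. *)
Lemma Efron_Stein (J : seq (lattice d)) f : uniq J -> bounded_rv f ->
  (forall w w', {in J, forall z, site z w = site z w'} -> f w = f w') ->
  mean P (fun w => f w ^+ 2) <= mean P f ^+ 2 + \sum_(z <- J) influence z f.
Proof.
move=> uJ bf fJ.
pose Av K g := foldr average_site g K.
have bAv K g : bounded_rv g -> bounded_rv (Av K g).
  by move=> bg; elim: K => //= z K IH; exact: bounded_rv_average_site.
have mAv K g : bounded_rv g -> mean P (Av K g) = mean P g.
  by move=> bg; elim: K => //= z K IH; rewrite (mean_average_site z (bAv K g bg)).
have local K : forall w w',
    {in [seq z <- J | z \notin K], forall z, site z w = site z w'} ->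
    Av K f w = Av K f w'.
  elim: K => [|y K IH] w w' ww' /=.
    by apply: fJ => z zJ; apply: ww'; rewrite mem_filter.
  apply: eq_mean => w''; apply: IH => z; rewrite mem_filter => /andP[zK zJ].
  rewrite !site_resample; case: eqVneq => // zy.
  by apply: ww'; rewrite mem_filter inE negb_or zy zK.
have AvJ w : Av J f w = mean P f.
  rewrite -(mAv J)// -[LHS](mean_cst P); apply: eq_mean => w'; apply: local => z.
  by rewrite mem_filter; case: (z \in J).
have infl z K : z \notin K -> influence z (Av K f) <= influence z f.
  elim: K => [_|y K IH]; first exact: lexx.
  rewrite [Av _ _]/= inE negb_or => /andP[zy zK].
  by apply: le_trans (IH zK); apply: influence_average_site (bAv _ _ bf); rewrite eq_sym.
have step_ K : uniq K -> mean P (fun w => f w ^+ 2) <=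
    mean P (fun w => Av K f w ^+ 2) + \sum_(z <- K) influence z f.
  elim: K => [|z K IH] /=; first by rewrite big_nil addr0.
  move=> /andP[zK uK]; rewrite big_cons addrA (le_trans (IH uK))// lerD2r.
  by have := infl _ _ zK; rewrite (influenceE _ (bAv K f bf)); lra.
have -> : mean P f ^+ 2 = mean P (fun w => Av J f w ^+ 2); last exact: step_.
by rewrite -[LHS](mean_cst P); apply: eq_mean => w; rewrite AvJ.
Qed.

End Resampling.

(** * Path sums in a random potential *)

Section Measurability.
Context {R : realType} {d : nat} {dT : measure_display} {T : measurableType dT}.
Variables (x : lattice d) (V : T -> lattice d -> R).
Hypothesis mV : forall z, measurable_fun setT (V ^~ z).

Lemma measurable_avg (F : T -> lattice d -> R) y :
  (forall u, measurable_fun setT (F ^~ u)) ->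
  measurable_fun setT (fun w => avg (F w) y).
Proof.
move=> mF; apply: measurable_funM; first exact: measurable_cst.
by apply: measurable_sum => s; exact: mF.
Qed.

Lemma measurable_expR_potential a y :
  measurable_fun setT (fun w => expR (a - V w y)).
Proof.
apply: (measurableT_comp (@measurable_expR R)).
by apply: measurable_funB => //; exact: measurable_cst.
Qed.

Lemma measurable_hit N y : measurable_fun setT (fun w => hit x (V w) N y).
Proof.
elim: N y => [|N IH] y /=; case: (y == x); try exact: measurable_cst.
apply: measurable_funM; last by apply: measurable_avg.
apply: (eq_measurable_fun (fun w => expR (0 - V w y))); last exact: measurable_expR_potential.
by move=> w _; rewrite sub0r.
Qed.

Lemma measurable_visit z N y : measurable_fun setT (fun w => visit x (V w) z N y).
Proof.
elim: N y => [|N IH] y.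
  rewrite -[X in measurable_fun _ X]/(fun w => if y == x then 0
    else if y == z then hit x (V w) 0 y else 0).
  by case: (y == x); case: (y == z); try exact: measurable_cst; exact: measurable_hit.
rewrite -[X in measurable_fun _ X]/(fun w => if y == x then 0
  else if y == z then hit x (V w) N.+1 y
  else expR (- V w y) * avg (visit x (V w) z N) y).
case: (y == x); first exact: measurable_cst.
case: (y == z); first exact: measurable_hit.
apply: measurable_funM; last by apply: measurable_avg.
apply: (eq_measurable_fun (fun w => expR (0 - V w y))); last exact: measurable_expR_potential.
by move=> w _; rewrite sub0r.
Qed.

Lemma measurable_range_weight eps N A y :
  measurable_fun setT (fun w => range_weight x (V w) eps N A y).
Proof.
elim: N A y => [|N IH] A y /=; case: (y == x); try exact: measurable_cst.
apply: measurable_funM; last by apply: measurable_avg => u; exact: IH.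
by case: (y \in A); [exact: measurable_cst|exact: measurable_expR_potential].
Qed.

End Measurability.

Lemma range_weight_local {R : realType} {d : nat} (x : lattice d)
    (V V' : lattice d -> R) eps N A y : (forall u, u \notin A -> V u = V' u) ->
  range_weight x V eps N A y = range_weight x V' eps N A y.
Proof.
elim: N A y => [//|N IH] A y VV' /=; case: ifP => // _.
have -> : avg (range_weight x V eps N (y :: A)) y
    = avg (range_weight x V' eps N (y :: A)) y.
  congr (_ * _); apply: eq_bigr => s _; apply: IH => u.
  by rewrite inE negb_or => /andP[_]; exact: VV'.
by case: ifP => // /negbT yA; rewrite VV'.
Qed.

Lemma integral_probability_cst {R : realType} dT (T : measurableType dT)
    (P : probability T R) (a : R) : (\int[P]_w a%:E = a%:E)%E.
Proof. by rewrite integral_cst// [X in (_ * X)%E](probability_setT P) mule1. Qed.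

Section Environment.
Context {R : realType} {d : nat} (d0 : (0 < d)%N).
Variable P : probability (potential R d) R.
Hypothesis indep : mutually_independent P (@site R d).
Hypothesis ident : identically_distributed P (@site R d).
Variable c : R.
Hypothesis c0 : 0 <= c.

(** When the law of the sites is bounded away from 0, flooring the potential
changes it only on a null set, and makes the lower bound on the potential hold
everywhere. *)
Definition floored (w : potential R d) (z : lattice d) : R :=
  Num.max c (site z w).

Lemma site_ge0 z (w : potential R d) : 0 <= site z w.
Proof. by rewrite /site. Qed.

Lemma floored_ge0 w z : 0 <= floored w z.
Proof. by rewrite le_max site_ge0 orbT. Qed.

Lemma floored_ge w z : c <= floored w z.
Proof. by rewrite le_max lexx. Qed.

Lemma floored_le w z : floored w z <= c + site z w.
Proof. by rewrite ge_max lerDl lerDr c0 site_ge0. Qed.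

Lemma site_le_floored w z : site z w <= floored w z.
Proof. by rewrite le_max lexx orbT. Qed.

Lemma measurable_floored z : measurable_fun setT (floored ^~ z).
Proof. apply: measurable_maxr; [exact: measurable_cst|exact: measurable_site]. Qed.

Lemma floored_resample z w w' y :
  floored (resample z w w') y = if y == z then floored w' y else floored w y.
Proof. by rewrite /floored site_resample; case: ifP. Qed.

Lemma integral_site z (g : R -> \bar R) : measurable_fun setT g ->
  (forall r, (0 <= g r)%E) ->
  (\int[P]_w g (site z w) = \int[P]_w g (site 0%R w))%E.
Proof.
move=> mg g0.
have E y : (\int[P]_w g (site y w) =
    \int[pushforward P (@site R d y)]_r g r)%E.
  by rewrite ge0_integral_pushforward//; exact: measurable_site.
rewrite !E; apply: eq_measure_integral => A mA _; exact: ident.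
Qed.

Lemma integral_avg_le (F : potential R d -> lattice d -> R) y (a : R) :
  (forall u, measurable_fun setT (F ^~ u)) -> (forall w u, 0 <= F w u) ->
  (forall u, \int[P]_w (F w u)%:E <= a%:E)%E ->
  (\int[P]_w (avg (F w) y)%:E <= a%:E)%E.
Proof.
move=> mF F0 Fa; rewrite /avg.
under eq_integral do rewrite EFinM -sumEFin.
have mFE u : measurable_fun setT (fun w => (F w u)%:E) by exact/measurable_EFinP.
rewrite ge0_integralZl//; first last.
- by move=> w _; apply: sume_ge0 => s _; rewrite lee_fin.
- exact: emeasurable_sum.
rewrite ge0_integral_sum//; last by move=> s w _; rewrite lee_fin.
apply: (@le_trans _ _ (((2 * d)%:R^-1)%:E * \sum_(s : 'I_d * bool) a%:E)%E).
  by rewrite lee_pmul2l ?lte_fin ?invr_gt0 ?ltr0n ?muln_gt0//; exact: lee_sum.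
by rewrite sumEFin -EFinM lee_fin -[leRHS](avg_cst d0 a y).
Qed.

(** Each newly visited site contributes an independent factor of mean at most
1. *)
Lemma integral_range_weight x eps N A y :
  (\int[P]_w (expR (eps - site 0%R w))%:E <= 1)%E ->
  (\int[P]_w (range_weight x (floored w) eps N A y)%:E <= 1)%E.
Proof.
move=> eps1; elim: N A y => [|N IH] A y.
  rewrite /=; by case: (y == x); rewrite integral_probability_cst lee_fin.
have [->|yx] := eqVneq y x.
  under eq_integral do rewrite /= eqxx.
  by rewrite integral_probability_cst.
under eq_integral do rewrite /= (negPf yx).
have mrw u B : measurable_fun setT (fun w => range_weight x (floored w) eps N B u).
  by apply: measurable_range_weight => z; exact: measurable_floored.
have avg1 : (\int[P]_w (avg (range_weight x (floored w) eps N (y :: A)) y)%:E <= 1)%E.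
  by apply: integral_avg_le => // w u; exact: range_weight_ge0.
case: (boolP (y \in A)) => yA; first by under eq_integral do rewrite mul1r.
have me : measurable_fun setT (fun w => expR (eps - floored w y)).
  by apply: measurable_expR_potential => z; exact: measurable_floored.
have mavg : measurable_fun setT
    (fun w => avg (range_weight x (floored w) eps N (y :: A)) y).
  by apply: measurable_avg => u; exact: mrw.
under eq_integral do rewrite EFinM.
rewrite (@integral_siteM _ _ _ indep y (fun w => (expR (eps - floored w y))%:E)
  (fun w => (avg (range_weight x (floored w) eps N (y :: A)) y)%:E)); first last.
- move=> w w'; congr (_%:E); congr (_ * _); apply: eq_bigr => s _.
  apply: range_weight_local => u; rewrite inE negb_or => /andP[uy _].
  by rewrite floored_resample (negPf uy).
- by move=> w w' ww'; rewrite /floored ww'.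
- by move=> w; rewrite lee_fin avg_ge0// => u; exact: range_weight_ge0.
- by move=> w; rewrite lee_fin expR_ge0.
- exact/measurable_EFinP.
- exact/measurable_EFinP.
rewrite -[leRHS]mule1; apply: lee_pmul; last exact: avg1.
- by apply: integral_ge0 => w _; rewrite lee_fin expR_ge0.
- apply: integral_ge0 => w _; rewrite lee_fin avg_ge0// => u.
  exact: range_weight_ge0.
apply: le_trans eps1.
rewrite -(@integral_site y (fun r => (expR (eps - r))%:E)); last 2 first.
- apply/measurable_EFinP; apply: (measurableT_comp (@measurable_expR R)).
  by apply: measurable_funB; [exact: measurable_cst|exact: measurable_id].
- by move=> r; rewrite lee_fin expR_ge0.
apply: ge0_le_integral => //.
- exact/measurable_EFinP.
- apply/measurable_EFinP; apply: (measurable_expR_potential (V := fun w z => site z w)).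
  exact: measurable_site.
- by move=> w _; rewrite lee_fin ler_expR lerB// site_le_floored.
Qed.

Lemma integral_expR_sum (p : seq (lattice d)) gamma (B : R) : uniq p ->
  (forall z, \int[P]_w (expR (gamma * floored w z))%:E <= B%:E)%E ->
  (\int[P]_w (expR (gamma * \sum_(z <- p) floored w z))%:E <= (B ^+ size p)%:E)%E.
Proof.
move=> + VB; elim: p => [_|z p IH].
  under eq_integral do rewrite big_nil mulr0 expR0.
  by rewrite integral_probability_cst.
move=> /= /andP[zp up].
have ms q : measurable_fun setT (fun w => expR (gamma * \sum_(z <- q) floored w z)).
  apply: (measurableT_comp (@measurable_expR R)); apply: measurable_funM.
    exact: measurable_cst.
  by apply: measurable_sum => u; exact: measurable_floored.
have mz : measurable_fun setT (fun w => expR (gamma * floored w z)).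
  have -> : (fun w => expR (gamma * floored w z))
      = (fun w => expR (gamma * \sum_(u <- [:: z]) floored w u)).
    by apply/funext => w; rewrite big_seq1.
  exact: ms.
under eq_integral do rewrite big_cons mulrDr expRD EFinM.
rewrite (@integral_siteM _ _ _ indep z (fun w => (expR (gamma * floored w z))%:E)
  (fun w => (expR (gamma * \sum_(z <- p) floored w z))%:E)); first last.
- move=> w w'; congr (expR (_ * _))%:E; rewrite !big_seq; apply: eq_bigr => u up'.
  by rewrite floored_resample; case: eqVneq => // uz; rewrite -uz up' in zp.
- by move=> w w' ww'; rewrite /floored ww'.
- by move=> w; rewrite lee_fin expR_ge0.
- by move=> w; rewrite lee_fin expR_ge0.
- exact/measurable_EFinP.
- exact/measurable_EFinP.
rewrite exprS EFinM; apply: lee_pmul; [| |exact: VB|exact: IH].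
- by apply: integral_ge0 => w _; rewrite lee_fin expR_ge0.
- by apply: integral_ge0 => w _; rewrite lee_fin expR_ge0.
Qed.

End Environment.

(** * From a variance bound for exponentials to exponential concentration *)

Section Exponential.
Context {R : realType}.
Implicit Types t : R.

Lemma expR_sub1_le t : expR t - 1 <= t * expR t.
Proof.
have := expR_ge1Dx (- t); have := expR_gt0 t; have := expRxMexpNx_1 t.
set a := expR t; set b := expR (- t) => ab a0 b1.
have : a * (1 + - t) <= a * b by rewrite ler_pM2l.
lra.
Qed.

Lemma sqr_le_expR t : 0 <= t -> t ^+ 2 <= 4 * expR t.
Proof.
move=> t0; have -> : expR t = expR (t / 2) ^+ 2.
  by rewrite -expRM_natr; congr expR; field.
have := expR_ge1Dx (t / 2); have : 0 <= t / 2 by rewrite divr_ge0.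
nra.
Qed.

Lemma expR_le_quadratic t : `|t| <= 2^-1 -> expR t <= 1 + t + 2 * t ^+ 2.
Proof.
rewrite ler_norml => /andP[t1 t2].
have := expR_ge1Dx (- t); have := expR_gt0 t; have := expRxMexpNx_1 t.
set a := expR t; set b := expR (- t) => ab a0 b1.
have h : a * (1 - t) <= 1 by rewrite -[leRHS]ab ler_pM2l.
have t1' : 0 < 1 - t by lra.
rewrite -(ler_pM2r t1') (le_trans h)//.
have : 0 <= t ^+ 2 * (1 - 2 * t) by rewrite mulr_ge0 ?sqr_ge0//; lra.
lra.
Qed.

Lemma expRN2_le t : 0 <= t -> t <= 2^-1 -> expR (- (2 * t)) <= 1 - t.
Proof.
move=> t0 t1; have := expR_ge1Dx t; have := expRxMexpNx_1 t.
have -> : expR (- (2 * t)) = expR (- t) ^+ 2.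
  by rewrite -expRM_natr; congr expR; ring.
have := expR_gt0 (- t).
set a := expR t; set b := expR (- t) => b0 ab a1.
have h : b * (1 + t) <= 1 by rewrite mulrC -[leRHS]ab ler_pM2r.
have h2 : b ^+ 2 * (1 + t) ^+ 2 <= 1.
  rewrite -exprMn -[leRHS](expr1n _ 2) lerXn2r ?nnegrE//.
  by rewrite mulr_ge0 ?ltW//; lra.
have t2' : 0 < (1 + t) ^+ 2 by rewrite exprn_gt0//; lra.
rewrite -(ler_pM2r t2') (le_trans h2)//.
have : 0 <= t * (1 - t - t ^+ 2) by rewrite mulr_ge0//; nra.
lra.
Qed.

(** The contribution of one site to the Efron-Stein bound for [expR (l / 2 * y)]
when [y] increases by at most [q * a]: it is of order [l ^ 2] and linear in [q],
and the mean over [a] costs no more than an exponential moment. *)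
Lemma pos_sqr_expR_le (theta l q a y y' : R) : 0 < theta -> 0 <= l <= theta ->
  0 <= q <= 1 -> 0 <= a -> y' <= y + q * a ->
  pos_sqr (expR (l / 2 * y') - expR (l / 2 * y))
  <= l ^+ 2 / theta ^+ 2 * (q * expR (l * y)) * expR (2 * theta * a).
Proof.
move=> theta0 /andP[l0 lt] /andP[q0 q1] a0 y'y.
set s := l / 2 * (q * a).
have s0 : 0 <= s by rewrite !mulr_ge0.
have le1 : expR (l / 2 * y') - expR (l / 2 * y) <= expR (l / 2 * y) * (s * expR s).
  apply: (@le_trans _ _ (expR (l / 2 * y) * (expR s - 1))).
    rewrite mulrBr mulr1 -expRD lerD2r ler_expR /s -mulrDr ler_wpM2l//.
    by rewrite divr_ge0.
  by rewrite ler_wpM2l ?expR_ge0// expR_sub1_le.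
apply: (le_trans (pos_sqr_homo le1)).
have rhs0 : 0 <= expR (l / 2 * y) * (s * expR s) by rewrite !mulr_ge0 ?expR_ge0.
rewrite /pos_sqr max_l//.
have -> : (expR (l / 2 * y) * (s * expR s)) ^+ 2 =
    (l / 2) ^+ 2 * (q * q) * expR (l * y) * (a ^+ 2 * expR (l * q * a)).
  have -> : expR (l * y) = expR (l / 2 * y) ^+ 2.
    by rewrite -expRM_natr; congr expR; field.
  have -> : expR (l * q * a) = expR s ^+ 2.
    by rewrite -expRM_natr; congr expR; rewrite /s; field.
  rewrite /s; ring.
have ea : a ^+ 2 * expR (l * q * a) <= 4 / theta ^+ 2 * expR (2 * theta * a).
  have -> : expR (2 * theta * a) = expR (theta * a) * expR (theta * a).
    by rewrite -expRD; congr expR; ring.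
  rewrite mulrA ler_pM ?sqr_ge0 ?expR_ge0//.
    rewrite -(ler_pM2l (exprn_gt0 2 theta0)).
    have -> : theta ^+ 2 * (4 / theta ^+ 2 * expR (theta * a)) = 4 * expR (theta * a).
      by field; rewrite gt_eqF.
    by rewrite -exprMn sqr_le_expR// mulr_ge0// ltW.
  by rewrite ler_expR ler_wpM2r// (le_trans _ lt)// ler_piMr.
have -> : l ^+ 2 / theta ^+ 2 * (q * expR (l * y)) * expR (2 * theta * a) =
    (l / 2) ^+ 2 * q * expR (l * y) * (4 / theta ^+ 2 * expR (2 * theta * a)).
  by field; rewrite gt_eqF.
apply: ler_pM => //; rewrite ?mulr_ge0 ?sqr_ge0 ?expR_ge0//.
rewrite ler_wpM2r ?expR_ge0// ler_wpM2l ?sqr_ge0//.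
by rewrite ler_piMr.
Qed.

End Exponential.

Section Iteration.
Context {R : realType} {dT : measure_display} {T : measurableType dT}.
Variables (P : probability T R) (Y : T -> R).
Hypothesis bY : bounded_rv Y.

Lemma integral_bounded_rv f : bounded_rv f ->
  (\int[P]_w (f w)%:E)%E = (mean P f)%:E.
Proof.
move=> bf; rewrite /Rintegral fineK//.
exact: (integrable_fin_num measurableT (bounded_rv_integrable P bf)).
Qed.

Lemma bounded_rv_expR (f : T -> R) : bounded_rv f -> bounded_rv (fun w => expR (f w)).
Proof.
move=> [mf [M fM]]; split; first exact: (measurableT_comp (@measurable_expR R)).
exists (expR M) => w; rewrite ger0_norm ?expR_ge0// ler_expR.
exact: le_trans (ler_norm _) (fM w).
Qed.

Let m := mean P Y.
Let H l := mean P (fun w => expR (l * (Y w - m))).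

Lemma bounded_rv_centered l : bounded_rv (fun w => l * (Y w - m)).
Proof.
by apply: (bounded_rvM (bounded_rv_cst l)); apply: bounded_rvB => //; exact: bounded_rv_cst.
Qed.

(** Near [l = 0] the moment generating function is [1 + O(l ^ 2)], with a constant
depending on the bound for [Y]; it starts the iteration in [mgf_le], where this
constant disappears. *)
Lemma mgf_small : exists2 M, 1 <= M &
  forall l, 0 <= l <= (2 * M)^-1 -> H l <= expR (2 * M ^+ 2 * l ^+ 2).
Proof.
have [mY [M0 YM0]] := bY.
have mM : `|m| <= M0 by exact: mean_bound.
pose M := M0 + M0 + 1; have M00 : 0 <= M0 := le_trans (normr_ge0 _) mM.
have M1 : 1 <= M by rewrite /M; lra.
have YM w : `|Y w - m| <= M.
  by rewrite (le_trans (ler_normB _ _))// (le_trans (lerD (YM0 w) mM))// lerDl.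
exists M => // l /andP[l0 lM].
have c0 : mean P (fun w => Y w - m) = 0.
  by rewrite (meanB _ bY (bounded_rv_cst m)) mean_cst subrr.
have bc : bounded_rv (fun w => Y w - m) by apply: bounded_rvB => //; exact: bounded_rv_cst.
apply: (@le_trans _ _ (mean P (fun w => (1 + 2 * M ^+ 2 * l ^+ 2) + l * (Y w - m)))).
  apply: le_mean; [exact/bounded_rv_expR/bounded_rv_centered| |].
    exact: (bounded_rvD (bounded_rv_cst _) (bounded_rv_centered l)).
  move=> w; have lYM : `|l * (Y w - m)| <= 2^-1.
    rewrite normrM ger0_norm//.
    have : l * `|Y w - m| <= (2 * M)^-1 * M by rewrite ler_pM.
    suff -> : (2 * M)^-1 * M = 2^-1 by [].
    by rewrite invfM -mulrA mulVf ?mulr1//; lra.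
  rewrite (le_trans (expR_le_quadratic lYM))//.
  have : (l * (Y w - m)) ^+ 2 <= M ^+ 2 * l ^+ 2.
    rewrite exprMn mulrC ler_wpM2r ?sqr_ge0// -real_normK ?num_real//.
    by rewrite lerXn2r ?nnegrE//; lra.
  lra.
rewrite (meanD _ (bounded_rv_cst _) (bounded_rv_centered l)) mean_cst (meanZ _ _ bc) c0.
by rewrite mulr0 addr0 expR_ge1Dx.
Qed.

(** Halving [l] squares the moment generating function up to a factor
[expR (2 * D * l ^+ 2)]; after [k] halvings the factors accumulate to at most
[expR (4 * D * l ^+ 2)] and what remains is governed by [mgf_small]. *)
Lemma mgf_le D l0 : 0 <= D -> 0 <= l0 -> D * l0 ^+ 2 <= 2^-1 ->
  (forall l, 0 <= l <= l0 -> mean P (fun w => expR (l * Y w)) <=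
    mean P (fun w => expR (l / 2 * Y w)) ^+ 2
    + D * l ^+ 2 * mean P (fun w => expR (l * Y w))) ->
  H l0 <= expR ((4 * D + 1) * l0 ^+ 2).
Proof.
move=> D0 l00 Dl0 step.
have HE l : H l = expR (- (l * m)) * mean P (fun w => expR (l * Y w)).
  rewrite /H -meanZ; last first.
    by apply/bounded_rv_expR/bounded_rvM => //; exact: bounded_rv_cst.
  by apply: eq_mean => w; rewrite -expRD; congr expR; ring.
have H0 l : 0 <= H l by apply: Rintegral_ge0 => w _; exact: expR_ge0.
have half l : 0 <= l <= l0 -> H l <= H (l / 2) ^+ 2 * expR (2 * D * l ^+ 2).
  move=> ll; have /andP[lge0 ll0] := ll.
  have Dl : D * l ^+ 2 <= 2^-1.
    by rewrite (le_trans _ Dl0)// ler_wpM2l// lerXn2r ?nnegrE.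
  have h1 : H l * (1 - D * l ^+ 2) <= H (l / 2) ^+ 2.
    rewrite !HE exprMn -expRM_natr.
    have -> : - (l / 2 * m) * 2 = - (l * m) by field.
    rewrite -mulrA ler_wpM2l ?expR_ge0//.
    by have := step _ ll; lra.
  have h2 : expR (- (2 * (D * l ^+ 2))) <= 1 - D * l ^+ 2.
    by rewrite expRN2_le// mulr_ge0// sqr_ge0.
  have h3 : H l * expR (- (2 * (D * l ^+ 2))) <= H (l / 2) ^+ 2.
    by rewrite (le_trans _ h1)// ler_wpM2l.
  have -> : 2 * D * l ^+ 2 = 2 * (D * l ^+ 2) by ring.
  rewrite -(ler_pM2r (expR_gt0 (- (2 * (D * l ^+ 2))))) (le_trans h3)//.
  by rewrite -mulrA expRxMexpNx_1 mulr1.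
have [M M1 small] := mgf_small.
have M0 : 0 < M by rewrite (lt_le_trans _ M1).
have iter_ k : forall l, 0 <= l <= l0 -> l <= 2 ^+ k * (2 * M)^-1 ->
    H l <= expR ((2 * M ^+ 2 / 2 ^+ k + 4 * D) * l ^+ 2).
  elim: k => [|k IH] l /andP[lge0 ll0] lk.
    rewrite (le_trans (small _ _))//; first by rewrite lge0 -[leRHS]mul1r.
    rewrite ler_expR expr0 divr1 ler_wpM2r ?sqr_ge0// lerDl mulr_ge0//.
  have l2 : 0 <= l / 2 by rewrite divr_ge0.
  have IHl : H (l / 2) <= expR ((2 * M ^+ 2 / 2 ^+ k + 4 * D) * (l / 2) ^+ 2).
    apply: IH; first by rewrite l2/= (le_trans _ ll0)//; lra.
    by move: lk; rewrite (exprS _ k) -mulrA; set b := _ ^+ k * _; lra.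
  rewrite (le_trans (half l _)) ?lge0//.
  have -> : (2 * M ^+ 2 / 2 ^+ k.+1 + 4 * D) * l ^+ 2 =
      (2 * M ^+ 2 / 2 ^+ k + 4 * D) * (l / 2) ^+ 2 * 2 + 2 * D * l ^+ 2.
    have : 2 ^+ k != 0 :> R by rewrite expf_neq0// pnatr_eq0.
    by rewrite (exprS _ k); move: (2 ^+ k) => b b0; field.
  rewrite expRD expRM_natr ler_wpM2r ?expR_ge0// lerXn2r ?nnegrE ?expR_ge0//.
(* So many halvings bring [l0] into the range of [mgf_small] and make its
   constant at most 1. *)
pose k := (Num.bound (l0 * (2 * M)) + Num.bound (2 * M ^+ 2))%N.
have k2 a : 0 <= a -> (Num.bound a <= k)%N -> a <= 2 ^+ k :> R.
  move=> a0 ak; rewrite (le_trans (ltW (archi_boundP a0)))//.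
  by rewrite -natrX ler_nat (leq_trans ak)// ltnW// ltn_expl.
have l0k : l0 <= 2 ^+ k * (2 * M)^-1.
  rewrite ler_pdivlMr ?mulr_gt0// k2 ?leq_addr// mulr_ge0// mulr_ge0// ltW//.
rewrite (le_trans (iter_ k l0 _ l0k)) ?l00 ?lexx//.
rewrite ler_expR ler_wpM2r ?sqr_ge0// addrC lerD2l ler_pdivrMr ?exprn_gt0// mul1r.
by rewrite k2 ?leq_addl// mulr_ge0// sqr_ge0.
Qed.

Lemma chernoff_bound (l s : R) : 0 <= l ->
  (P [set w | (m + s <= Y w)%R] <= (expR (- (l * s)) * H l)%:E)%E.
Proof.
move=> l0; have [mY _] := bY.
have mA : measurable [set w | m + s <= Y w].
  have -> : [set w | m + s <= Y w] = Y @^-1` `[m + s, +oo[.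
    by apply/seteqP; split => w /=; rewrite in_itv/= andbT.
  rewrite -[X in measurable X]setTI; apply: mY => //.
have be : bounded_rv (fun w => expR (- (l * s)) * expR (l * (Y w - m))).
  by apply: (bounded_rvM (bounded_rv_cst _)); exact/bounded_rv_expR/bounded_rv_centered.
rewrite -[X in P X]setIT -integral_indic// /H -meanZ; last first.
  exact/bounded_rv_expR/bounded_rv_centered.
rewrite -integral_bounded_rv//; apply: ge0_le_integral => //.
- by apply/measurable_EFinP; exact: measurable_indic.
- by apply/measurable_EFinP; case: be.
move=> w _; rewrite lee_fin indicE; case: (boolP (w \in _)) => [|_].
  rewrite inE/= => mY'; rewrite -expRD -[leLHS]expR0 ler_expR -mulrN -mulrDr.
  by rewrite mulr_ge0//; lra.
by rewrite mulr_ge0// expR_ge0.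
Qed.

End Iteration.

(** * Concentration of the cost of reaching the target in a bounded time *)

Section TruncatedCost.
Context {R : realType} {d : nat} (d0 : (0 < d)%N).
Variable P : probability (potential R d) R.
Hypothesis indep : mutually_independent P (@site R d).
Hypothesis ident : identically_distributed P (@site R d).
Variables c K gamma theta Bgamma eps : R.
Hypothesis c0 : 0 <= c.
Hypothesis K1 : 1 <= K.
Hypothesis loops : @loops_bounded R d c K.
Hypothesis gamma0 : 0 < gamma.
Hypothesis moment :
  (\int[P]_w (expR (gamma * site (0%R : lattice d) w))%:E <= Bgamma%:E)%E.
(* [theta] is small enough for the products of exponentials below, of exponents
   up to [4 * theta], to be controlled by the moment of order [gamma]. *)
Hypothesis theta_gt0 : 0 < theta.
Hypothesis theta_le1 : 4 * theta <= 1.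
Hypothesis theta_gamma : 4 * theta <= gamma.
Hypothesis eps0 : 0 < eps.
Hypothesis killing :
  (\int[P]_w (expR (eps - site (0%R : lattice d) w))%:E <= 1)%E.

Definition truncated_cost (x : lattice d) N (w : potential R d) : R :=
  - ln (hit x (floored c w) N 0).

Lemma direct_path x : exists p : seq (lattice d), [/\ (size p <= l1norm x)%N, uniq p &
  forall (V : lattice d -> R) N, (l1norm x <= N)%N ->
    (2 * d)%:R^-1 ^+ size p * expR (- \sum_(z <- p) V z) <= hit x V N 0].
Proof.
have [p [sp up _ pV]] := @hit_direct_path R d x _ 0 (congr1 (@l1norm d) (subr0 x)).
by exists p.
Qed.

Lemma dd_gt0 : 0 < (2 * d)%:R :> R.
Proof. by rewrite ltr0n muln_gt0. Qed.

Lemma hit_gt0 x (V : lattice d -> R) N : (l1norm x <= N)%N -> 0 < hit x V N 0.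
Proof.
move=> xN; have [p [_ _ pV]] := direct_path x.
by apply: lt_le_trans (pV V N xN); rewrite mulr_gt0 ?expR_gt0// exprn_gt0 ?invr_gt0 ?dd_gt0.
Qed.

Lemma truncated_cost_ge0 x N w : 0 <= truncated_cost x N w.
Proof.
rewrite oppr_ge0 ln_le0//; apply: hit_le1 => // u; exact: floored_ge0.
Qed.

Lemma measurable_truncated_cost x N : measurable_fun setT (truncated_cost x N).
Proof.
apply: (measurableT_comp (@oppr_measurable R setT)).
apply: (measurableT_comp (@measurable_ln R)); apply: measurable_hit => z.
exact: measurable_floored.
Qed.

Lemma truncated_cost_le x N (p : seq (lattice d)) w :
  (2 * d)%:R^-1 ^+ size p * expR (- \sum_(z <- p) floored c w z)
    <= hit x (floored c w) N 0 ->
  truncated_cost x N w <= (size p)%:R * ln (2 * d)%:R + \sum_(z <- p) floored c w z.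
Proof.
move=> pw; have dd0 := dd_gt0.
have l0 : 0 < (2 * d)%:R^-1 ^+ size p * expR (- \sum_(z <- p) floored c w z) :> R.
  by rewrite mulr_gt0 ?expR_gt0// exprn_gt0 ?invr_gt0.
have : ln ((2 * d)%:R^-1 ^+ size p * expR (- \sum_(z <- p) floored c w z))
    <= ln (hit x (floored c w) N 0).
  by rewrite ler_ln ?posrE// (lt_le_trans l0).
rewrite lnM ?posrE ?expR_gt0 ?exprn_gt0 ?invr_gt0// expRK lnXn ?invr_gt0// lnV ?posrE//.
by rewrite /truncated_cost -mulr_natl; lra.
Qed.

(** The direct path to [x] visits each of its sites once, so its cost is a sum
of independent terms. *)
Lemma integral_expR_truncated_cost : exists2 B : R, 1 <= B &
  forall x N, (l1norm x <= N)%N ->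
  (\int[P]_w (expR (gamma * truncated_cost x N w))%:E <= (B ^+ l1norm x)%:E)%E.
Proof.
pose B1 := expR (gamma * c) * Bgamma.
pose B := Num.max 1 (expR (gamma * ln (2 * d)%:R) * B1).
have mexp z : measurable_fun setT (fun w => expR (gamma * site z w)).
  apply: (measurableT_comp (@measurable_expR R)); apply: measurable_funM.
    exact: measurable_cst.
  exact: measurable_site.
have VB z : (\int[P]_w (expR (gamma * floored c w z))%:E <= B1%:E)%E.
  apply: (@le_trans _ _ (\int[P]_w ((expR (gamma * c))%:E * (expR (gamma * site z w))%:E))%E).
    apply: ge0_le_integral => //.
    - apply/measurable_EFinP; apply: (measurableT_comp (@measurable_expR R)).
      by apply: measurable_funM; [exact: measurable_cst|exact: measurable_floored].
    - apply: emeasurable_funM; first exact: measurable_cst.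
      exact/measurable_EFinP.
    - move=> w _; rewrite -EFinM lee_fin -expRD ler_expR -mulrDr ler_wpM2l ?(ltW gamma0)//.
      exact: floored_le.
  rewrite ge0_integralZl//; last exact/measurable_EFinP.
  rewrite EFinM; apply: lee_wpmul2l; first by rewrite lee_fin expR_ge0.
  apply: le_trans moment.
  rewrite (integral_site ident z (g := fun r => (expR (gamma * r))%:E))//.
  apply/measurable_EFinP; apply: (measurableT_comp (@measurable_expR R)).
  by apply: measurable_funM; [exact: measurable_cst|exact: measurable_id].
have B10 : 0 <= B1.
  rewrite -lee_fin (le_trans _ (VB 0))//; apply: integral_ge0 => w _.
  by rewrite lee_fin expR_ge0.
exists B; first by rewrite le_max lexx.
move=> x N xN; have [p [sp up pV]] := direct_path x.
set a := expR (gamma * ln (2 * d)%:R).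
have ms : measurable_fun setT (fun w => expR (gamma * \sum_(z <- p) floored c w z)).
  apply: (measurableT_comp (@measurable_expR R)); apply: measurable_funM.
    exact: measurable_cst.
  by apply: measurable_sum => u; exact: measurable_floored.
apply: (@le_trans _ _ (\int[P]_w ((a ^+ size p)%:E
    * (expR (gamma * \sum_(z <- p) floored c w z))%:E))%E).
  apply: ge0_le_integral => //.
  - apply/measurable_EFinP; apply: (measurableT_comp (@measurable_expR R)).
    by apply: measurable_funM; [exact: measurable_cst|exact: measurable_truncated_cost].
  - by apply: emeasurable_funM; [exact: measurable_cst|exact/measurable_EFinP].
  - move=> w _; rewrite -EFinM lee_fin /a -expRM_natr -expRD ler_expR -mulrA -mulrDr.
    rewrite ler_wpM2l ?(ltW gamma0)//.
    by have := truncated_cost_le (pV _ _ xN); rewrite mulrC.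
rewrite ge0_integralZl//; [|exact/measurable_EFinP|by rewrite lee_fin exprn_ge0// expR_ge0].
apply: (@le_trans _ _ ((a ^+ size p)%:E * (B1 ^+ size p)%:E)%E).
  apply: lee_wpmul2l; first by rewrite lee_fin exprn_ge0// expR_ge0.
  exact: (integral_expR_sum indep up VB).
rewrite -EFinM lee_fin -exprMn (@le_trans _ _ (B ^+ size p))//.
  have aB0 : 0 <= a * B1 by rewrite mulr_ge0 ?expR_ge0.
  have aB : a * B1 <= B by rewrite le_max lexx orbT.
  by rewrite lerXn2r ?nnegrE// (le_trans aB0).
by rewrite ler_weXn2l// le_max lexx.
Qed.

(** The probability that [z] is visited, under the path measure defining
[truncated_cost x N w]. *)
Definition visit_prob (x : lattice d) N z (w : potential R d) : R :=
  visit x (floored c w) z N 0 / hit x (floored c w) N 0.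

Lemma visit_prob_itv x N z w : (l1norm x <= N)%N -> 0 <= visit_prob x N z w <= 1.
Proof.
move=> xN; have e0 := hit_gt0 (floored c w) xN.
rewrite /visit_prob divr_ge0 ?visit_ge0 ?(ltW e0)//= ler_pdivrMr// mul1r.
have [->|zx] := eqVneq z x; last by rewrite (hit_split _ _ _ zx) lerDr avoid_ge0.
suff -> : visit x (floored c w) x N 0 = 0 by exact: ltW.
elim: N {xN e0} 0 => [|N IH] y /=; case: eqVneq => //= yx.
by rewrite /avg big1 ?mulr0// => s _; exact: IH.
Qed.

(** The form of [cost_increase] used for resampling: the old value of the site is
bounded below by 0 and the new one above by [c + site z w']. *)
Lemma truncated_cost_resample x N z w w' : (l1norm x <= N)%N ->
  truncated_cost x N (resample z w w') <=
  truncated_cost x N w + visit_prob x N z w * (c + site z w' + ln K).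
Proof.
move=> xN; have [f [f0 fz fsup fz1]] := loops (floored_ge c w) z.
have le1 := @cost_increase R d x (floored c w) (floored c (resample z w w')) z N 0 f K
  (floored c w' z).
have /andP[q0 _] := visit_prob_itv z w xN.
apply: le_trans (_ : _ <= truncated_cost x N w
    + visit_prob x N z w * (floored c w' z + ln K)) _.
  apply: le1 => //; first exact: hit_gt0.
  - exact: floored_ge0.
  - by move=> u uz; rewrite floored_resample (negPf uz).
  - by rewrite floored_resample eqxx lerDr floored_ge0.
by rewrite lerD2l ler_wpM2l// lerD2r floored_le.
Qed.

(** [range_weight_ge] at the optimal point [m], the mean number of visited sites
in [J]; there the linear term vanishes. *)
Lemma visited_le x N (J : seq (lattice d)) w : (l1norm x <= N)%N -> uniq J ->
  expR (eps * \sum_(z <- J) visit_prob x N z w - truncated_cost x N w)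
  <= range_weight x (floored c w) eps N [::] 0.
Proof.
move=> xN uJ; have e0 := hit_gt0 (floored c w) xN.
set m := \sum_(z <- J) _.
have := @range_weight_ge R d x (floored c w) eps N [::] J 0 m uJ (ltW eps0)
  (floored_ge0 c w).
suff -> : (1 - eps * m) * hit x (floored c w) N 0
    + eps * \sum_(z <- J | z \notin [::]) visit x (floored c w) z N 0
    = hit x (floored c w) N 0.
  by rewrite expRD opprK lnK// posrE.
have -> : \sum_(z <- J | z \notin [::]) visit x (floored c w) z N 0
    = m * hit x (floored c w) N 0.
  rewrite /m mulr_suml; apply: eq_bigr => z _.
  by rewrite /visit_prob mulrVK// unitfE gt_eqF.
ring.
Qed.

Definition capped_cost (x : lattice d) N L (w : potential R d) : R :=
  Num.min (truncated_cost x N w) L.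

Lemma capped_cost_ge0 x N L w : 0 <= L -> 0 <= capped_cost x N L w.
Proof. by move=> L0; rewrite le_min truncated_cost_ge0. Qed.

Lemma bounded_rv_capped_cost x N L : 0 <= L -> bounded_rv (capped_cost x N L).
Proof.
move=> L0; split.
  by apply: measurable_minr; [exact: measurable_truncated_cost|exact: measurable_cst].
by exists L => w; rewrite ger0_norm ?capped_cost_ge0// ge_min lexx orbT.
Qed.

Lemma bounded_rv_expR_capped_cost l x N L : 0 <= L ->
  bounded_rv (fun w => expR (l * capped_cost x N L w)).
Proof.
move=> L0; apply/bounded_rv_expR/bounded_rvM; first exact: bounded_rv_cst.
exact: bounded_rv_capped_cost.
Qed.

Lemma bounded_rv_visit_prob x N z : (l1norm x <= N)%N ->
  bounded_rv (visit_prob x N z).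
Proof.
move=> xN; split; last first.
  by exists 1 => w; have /andP[q0 q1] := visit_prob_itv z w xN; rewrite ger0_norm.
have -> : visit_prob x N z
    = (fun w => visit x (floored c w) z N 0 * expR (truncated_cost x N w)).
  apply/funext => w; rewrite /visit_prob /truncated_cost expRN lnK// posrE.
  exact: hit_gt0.
apply: measurable_funM.
  by apply: measurable_visit => u; exact: measurable_floored.
exact: (measurableT_comp (@measurable_expR R) (measurable_truncated_cost x N)).
Qed.

Lemma bounded_rv_sum_visit_prob x N (J : seq (lattice d)) : (l1norm x <= N)%N ->
  bounded_rv (fun w => \sum_(z <- J) visit_prob x N z w).
Proof.
move=> xN; elim: J => [|z J IH].
  by under eq_fun do rewrite big_nil; exact: bounded_rv_cst.
under eq_fun do rewrite big_cons.
exact: (bounded_rvD (bounded_rv_visit_prob z xN) IH).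
Qed.

(** By [visited_le] the number [m] of visited sites is, up to the factor [eps],
at most the cost plus the logarithm of a variable of mean at most 1.  Both have
exponential tails on the scale [l1norm x], so the part of [m] beyond a multiple
of [l1norm x] is negligible. *)
Lemma mean_visits_le : exists2 C : R, 0 <= C &
  forall x N L l (J : seq (lattice d)), (0 < l1norm x <= N)%N -> 0 <= L ->
  0 <= l <= theta -> uniq J ->
  mean P (fun w => (\sum_(z <- J) visit_prob x N z w) * expR (l * capped_cost x N L w))
  <= C * (l1norm x)%:R * mean P (fun w => expR (l * capped_cost x N L w)).
Proof.
have th2 : theta * 2 <= 1 by move: theta_gt0 theta_le1; lra.
have th2g : 2 * theta * 2 <= gamma by move: theta_gamma; lra.
have [B B1 momentB] := integral_expR_truncated_cost.
have B2 : 1 <= 2 + B by rewrite (le_trans B1)// lerDr.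
(* For this [C] the factor [expR (- (theta * C * n))] beats [2 + B ^ n]. *)
have [C C0 CE] : exists2 C, 0 <= C & theta * C = ln (2 + B).
  exists (ln (2 + B) / theta); first by rewrite divr_ge0 ?ln_ge0// ltW.
  by rewrite mulrC divfK// gt_eqF.
have thetaV0 : 0 <= theta^-1 by rewrite invr_ge0 ltW.
have epsV0 : 0 <= eps^-1 by rewrite invr_ge0 ltW.
exists ((C + theta^-1) / eps); first by rewrite mulr_ge0// addr_ge0.
move=> x N L l J /andP[x0 xN] L0 /andP[l0 lt] uJ.
set n := l1norm x in x0 xN *; set Y := capped_cost x N L.
set m := fun w => \sum_(z <- J) visit_prob x N z w.
pose r w := range_weight x (floored c w) eps N [::] 0.
pose Z := truncated_cost x N.
pose a := C * n%:R / eps; pose b := expR (- (theta * (C * n%:R))) / theta / eps.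
have a0 : 0 <= a by rewrite /a !mulr_ge0.
have b0 : 0 <= b by rewrite /b !mulr_ge0 ?expR_ge0.
have bound w : m w * expR (l * Y w)
    <= a * expR (l * Y w) + b * (1 + (r w + expR (gamma * Z w))).
  have Z0 : 0 <= Z w by exact: truncated_cost_ge0.
  have YZ : l * Y w <= theta * Z w.
    by rewrite ler_pM ?capped_cost_ge0// ge_min lexx.
  have mr : expR (eps * m w - Z w) <= r w by exact: visited_le.
  (* [1 + t <= expR t] for the part of [m w] beyond [C * n / eps]. *)
  have m_le : m w <= C * n%:R / eps
      + expR (theta * (eps * m w - C * n%:R)) / theta / eps.
    rewrite -mulrDl ler_pdivlMr// -lerBlDl ler_pdivlMr// mulrC [m w * _]mulrC.
    by rewrite (le_trans _ (expR_ge1Dx _))// lerDr.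
  have e_le : expR (theta * (eps * m w)) * expR (l * Y w)
      <= 1 + (r w + expR (gamma * Z w)).
    apply: (@le_trans _ _ (expR (theta * (eps * m w - Z w)) * expR (2 * theta * Z w))).
      rewrite -!expRD ler_expR.
      rewrite [leRHS](_ : _ = theta * (eps * m w) + theta * Z w); last ring.
      by rewrite lerD2l.
    have e1 : expR (theta * (eps * m w - Z w)) ^+ 2 <= 1 + r w.
      rewrite -expRM_natr; have [h|h] := leP 0 (eps * m w - Z w).
        apply: (@le_trans _ _ (r w)); last by rewrite lerDr.
        by rewrite (le_trans _ mr)// ler_expR mulrAC -[leRHS]mul1r ler_wpM2r.
      apply: (@le_trans _ _ 1); last by rewrite lerDl range_weight_ge0.
      by rewrite expR_le1 mulr_le0_ge0// mulr_ge0_le0// ltW.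
    have e2 : expR (2 * theta * Z w) ^+ 2 <= expR (gamma * Z w).
      by rewrite -expRM_natr ler_expR mulrAC ler_wpM2r.
    move: e1 e2; set u := expR (_ * (_ - _)); set v := expR (2 * _ * _) => e1 e2.
    have := sqr_ge0 (u - v); have := sqr_ge0 u; have := sqr_ge0 v; lra.
  apply: (le_trans (ler_wpM2r (expR_ge0 _) m_le)).
  rewrite mulrDl lerD2l mulrBr expRD /b.
  have -> : expR (theta * (eps * m w)) * expR (- (theta * (C * n%:R))) / theta / eps
      * expR (l * Y w) = expR (- (theta * (C * n%:R))) / theta / eps
      * (expR (theta * (eps * m w)) * expR (l * Y w)) by ring.
  by rewrite ler_wpM2l.
have bE : bounded_rv (fun w => expR (l * Y w)) by exact: bounded_rv_expR_capped_cost.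
have bm : bounded_rv (fun w => m w * expR (l * Y w)).
  by apply: bounded_rvM => //; exact: bounded_rv_sum_visit_prob.
set M := mean P (fun w => expR (l * Y w)).
have mr : measurable_fun setT r.
  by apply: measurable_range_weight => z; exact: measurable_floored.
have mZ : measurable_fun setT (fun w => expR (gamma * Z w)).
  apply: (measurableT_comp (@measurable_expR R)).
  by apply: measurable_funM; [exact: measurable_cst|exact: measurable_truncated_cost].
have r0 w : 0 <= r w by exact: range_weight_ge0.
have main : mean P (fun w => m w * expR (l * Y w)) <= a * M + b * (2 + B ^+ n).
  rewrite -lee_fin -(integral_bounded_rv P bm).
  apply: (@le_trans _ _ (\int[P]_w ((a * expR (l * Y w))%:E
      + (b%:E * (1 + ((r w)%:E + (expR (gamma * Z w))%:E))))%E)%E).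
    apply: ge0_le_integral => //.
    - move=> w _; rewrite lee_fin mulr_ge0 ?expR_ge0// sumr_ge0// => z _.
      by have /andP[] := visit_prob_itv z w xN.
    - by apply/measurable_EFinP; case: bm.
    - apply: emeasurable_funD.
        apply/measurable_EFinP; apply: measurable_funM; first exact: measurable_cst.
        by case: bE.
      apply: emeasurable_funM; first exact: measurable_cst.
      apply: emeasurable_funD; first exact: measurable_cst.
      by apply: emeasurable_funD; exact/measurable_EFinP.
    - move=> w _.
      rewrite -[leRHS]/((a * expR (l * Y w) + b * (1 + (r w + expR (gamma * Z w))))%:E).
      by rewrite lee_fin bound.
  have mrZ : measurable_fun setT (fun w => ((r w)%:E + (expR (gamma * Z w))%:E)%E).
    by apply: emeasurable_funD; exact/measurable_EFinP.
  have m1rZ : measurable_fun setT (fun w => (1 + ((r w)%:E + (expR (gamma * Z w))%:E))%E).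
    by apply: emeasurable_funD => //; exact: measurable_cst.
  have maE : bounded_rv (fun w => a * expR (l * Y w)).
    exact: (bounded_rvM (bounded_rv_cst a) bE).
  have rZ0 w : (0 <= (r w)%:E + (expR (gamma * Z w))%:E)%E.
    by rewrite adde_ge0// lee_fin ?expR_ge0.
  have rZ1 w : (0 <= 1 + ((r w)%:E + (expR (gamma * Z w))%:E))%E by rewrite adde_ge0.
  rewrite ge0_integralD//; first last.
  - by apply: emeasurable_funM => //; exact: measurable_cst.
  - by move=> w _; rewrite mule_ge0.
  - by apply/measurable_EFinP; case: maE.
  - by move=> w _; rewrite lee_fin mulr_ge0 ?expR_ge0.
  rewrite (integral_bounded_rv P maE) (meanZ _ _ bE) -/M EFinD leeD//.
  rewrite ge0_integralZl// [leRHS]EFinM; apply: lee_wpmul2l => //.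
  rewrite ge0_integralD// integral_probability_cst.
  have -> : (2 + B ^+ n)%:E = (1 + (1 + (B ^+ n)%:E))%E :> \bar R.
    by rewrite -!EFinD addrA.
  rewrite leeD2l// ge0_integralD//; [|by move=> w _; rewrite lee_fin|exact/measurable_EFinP|exact/measurable_EFinP].
  by apply: leeD; [exact: integral_range_weight|exact: momentB].
have bB : b * (2 + B ^+ n) <= theta^-1 / eps.
  rewrite /b -!mulrA [_ * (_ + _)]mulrC !mulrA ler_pM2r ?invr_gt0//.
  rewrite mulrAC -[leRHS]mul1r ler_pM2r ?invr_gt0//.
  rewrite CE.
  rewrite expRN -ler_pdivlMl ?invr_gt0 ?expR_gt0// invrK mulr1.
  rewrite expRM_natr lnK ?posrE ?(lt_le_trans ltr01)//.
  case: (n) x0 => // k _; rewrite !exprS.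
  have Bk : 1 <= B ^+ k by rewrite exprn_ege1.
  have : B ^+ k <= (2 + B) ^+ k.
    by apply: lerXn2r; rewrite ?nnegrE ?(le_trans ler01) ?lerDr.
  move: Bk; set u := B ^+ k; set v := _ ^+ k; nra.
have M1 : 1 <= M.
  rewrite /M -(mean_cst P 1); apply: le_mean => //; first exact: bounded_rv_cst.
  by move=> w; rewrite -expR0 ler_expR mulr_ge0// capped_cost_ge0.
have n1 : 1 <= n%:R :> R by rewrite ler1n.
apply: (le_trans main); rewrite [leRHS](_ : _ = a * M + theta^-1 / eps * (n%:R * M)).
  rewrite lerD2l (le_trans bB)// ler_peMr//.
    by rewrite mulr_ge0.
  by rewrite -[leLHS]mulr1 ler_pM.
by rewrite /a; field; rewrite !gt_eqF.
Qed.

(** The mean over the resampled value of the bound in [pos_sqr_expR_le]. *)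
Let A1 := expR (2 * theta * (c + ln K)) * Bgamma / theta ^+ 2.

Let Bgamma_ge0 : 0 <= Bgamma.
Proof.
rewrite -lee_fin (le_trans _ moment)//; apply: integral_ge0 => w _.
by rewrite lee_fin expR_ge0.
Qed.

Lemma influence_capped_cost_le x N L l z : (l1norm x <= N)%N -> 0 <= L ->
  0 <= l <= theta ->
  influence P z (fun w => expR (l / 2 * capped_cost x N L w)) <=
  l ^+ 2 * A1 * mean P (fun w => visit_prob x N z w * expR (l * capped_cost x N L w)).
Proof.
move=> xN L0 lt; set Y := capped_cost x N L.
have bE k : bounded_rv (fun w => expR (k * Y w)) by exact: bounded_rv_expR_capped_cost.
have bq : bounded_rv (fun w => visit_prob x N z w * expR (l * Y w)).
  by apply: bounded_rvM => //; exact: bounded_rv_visit_prob.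
rewrite -(meanZ _ _ bq); apply: le_mean.
- apply: (bounded_rv_mean P P (f := fun w w' => pos_sqr (expR (l / 2 * Y (resample z w w'))
    - expR (l / 2 * Y w)))).
  exact: (bounded_rv_increase z (bE (l / 2))).
- exact: (bounded_rvM (bounded_rv_cst _) bq).
move=> w; set k := l ^+ 2 / theta ^+ 2 * (visit_prob x N z w * expR (l * Y w)).
have qw := visit_prob_itv z w xN.
have k0 : 0 <= k.
  case/andP: qw => q0 _; rewrite /k (mulr_ge0 (divr_ge0 (sqr_ge0 _) (sqr_ge0 _)))//.
  by rewrite mulr_ge0// expR_ge0.
have lnK0 : 0 <= ln K by rewrite ln_ge0.
have bi : bounded_rv (fun w' => pos_sqr (expR (l / 2 * Y (resample z w w'))
    - expR (l / 2 * Y w))).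
  apply/bounded_rv_pos_sqr/bounded_rvB; last exact: bounded_rv_cst.
  exact: (bounded_rv_resample_at z w (bE (l / 2))).
have Yres w' : Y (resample z w w') <= Y w
    + visit_prob x N z w * (c + site z w' + ln K).
  have h := truncated_cost_resample z w w' xN.
  have q0 : 0 <= visit_prob x N z w * (c + site z w' + ln K).
    by case/andP: qw => q0 _; rewrite mulr_ge0// !addr_ge0// site_ge0.
  rewrite /Y /capped_cost ge_min; case: (leP (truncated_cost x N w) L) => _.
    by rewrite h.
  by rewrite lerDl q0 orbT.
rewrite -lee_fin -(integral_bounded_rv P bi).
apply: (@le_trans _ _ (\int[P]_w' ((k * expR (2 * theta * (c + ln K)))%:E
    * (expR (gamma * site z w'))%:E))%E).
  apply: ge0_le_integral => //.
  - by move=> w' _; rewrite lee_fin pos_sqr_ge0.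
  - by apply/measurable_EFinP; case: bi.
  - apply: emeasurable_funM; first exact: measurable_cst.
    apply/measurable_EFinP; apply: (measurableT_comp (@measurable_expR R)).
    by apply: measurable_funM; [exact: measurable_cst|exact: measurable_site].
  move=> w' _; rewrite -EFinM lee_fin.
  have s0 := site_ge0 z w'.
  have a0 : 0 <= c + site z w' + ln K by rewrite !addr_ge0.
  apply: (le_trans (pos_sqr_expR_le theta_gt0 lt qw a0 (Yres w'))).
  rewrite -/k -[leRHS]mulrA; apply: ler_wpM2l => //; rewrite -expRD ler_expR.
  rewrite [leLHS](_ : _ = 2 * theta * (c + ln K) + 2 * theta * site z w'); last ring.
  rewrite lerD2l ler_wpM2r//; move: theta_gt0 theta_gamma; lra.
rewrite ge0_integralZl//; first last.
- by rewrite lee_fin mulr_ge0 ?expR_ge0.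
- apply/measurable_EFinP; apply: (measurableT_comp (@measurable_expR R)).
  by apply: measurable_funM; [exact: measurable_cst|exact: measurable_site].
rewrite (integral_site ident z (g := fun r => (expR (gamma * r))%:E)); last 2 first.
- apply/measurable_EFinP; apply: (measurableT_comp (@measurable_expR R)).
  by apply: measurable_funM; [exact: measurable_cst|exact: measurable_id].
- by move=> r; rewrite lee_fin expR_ge0.
apply: (@le_trans _ _ ((k * expR (2 * theta * (c + ln K)))%:E * Bgamma%:E)%E).
  by apply: lee_wpmul2l => //; rewrite lee_fin mulr_ge0 ?expR_ge0.
rewrite -EFinM lee_fin /k /A1 le_eqVlt; apply/orP; left; apply/eqP.
by field; rewrite gt_eqF.
Qed.

(** With [D] the constant of the variance bound, [l0] is chosen such that
[D * l0 ^ 2 <= 1 / 2], and [mgf_le] is used at [l0] divided by the square root of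
the norm of [x]. *)
Lemma capped_cost_concentration : exists C1 C2 : R, [/\ 0 < C1, 0 < C2 &
  forall x N L s, (0 < l1norm x <= N)%N -> 0 <= L -> 
  (P [set w | (mean P (capped_cost x N L) + s <= capped_cost x N L w)%R]
   <= (C1 * expR (- (C2 * (s / Num.sqrt (l1norm x)%:R))))%:E)%E].
Proof.
have [C C0 visits] := mean_visits_le.
have A10 : 0 <= A1.
  exact: divr_ge0 (mulr_ge0 (expR_ge0 _) Bgamma_ge0) (sqr_ge0 _).
pose D := A1 * C; have D0 : 0 <= D by exact: mulr_ge0 A10 C0.
pose l0 := Num.min theta (1 + 2 * D)^-1.
have D1 : 0 < 1 + 2 * D by rewrite ltr_pwDl// mulr_ge0.
have l00 : 0 < l0 by rewrite lt_min theta_gt0 invr_gt0.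
have l0t : l0 <= theta by rewrite ge_min lexx.
have l0D : l0 * (1 + 2 * D) <= 1.
  by rewrite -ler_pdivlMr// mul1r ge_min lexx orbT.
exists (expR ((4 * D + 1) * l0 ^+ 2)), l0; split => //; first exact: expR_gt0.
move=> x N L s /andP[x0 xN] L0; set n := l1norm x in x0 xN *.
have n1 : 1 <= n%:R :> R by rewrite ler1n.
have n0 : 0 < n%:R :> R by rewrite (lt_le_trans ltr01).
have sn1 : 1 <= Num.sqrt n%:R :> R by rewrite -[leLHS]sqrtr1 ler_sqrt.
have sn0 : 0 < Num.sqrt n%:R :> R by rewrite (lt_le_trans ltr01).
pose l := l0 / Num.sqrt n%:R.
have lge0 : 0 <= l := divr_ge0 (ltW l00) (ltW sn0).
have ll0 : l <= l0 by rewrite /l ler_pdivrMr// ler_peMr// ltW.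
have nl2 : n%:R * l ^+ 2 = l0 ^+ 2.
  by rewrite /l expr_div_n sqr_sqrtr ?ler0n// mulrC divfK// gt_eqF.
have bY := bounded_rv_capped_cost x N L0.
have mgf := @mgf_le R _ _ P _ bY (D * n%:R) l.
apply: le_trans (chernoff_bound P bY s lge0) _.
rewrite lee_fin mulrC ler_pM ?expR_ge0//.
- by apply: Rintegral_ge0 => w _; exact: expR_ge0.
- apply: (le_trans (mgf _ _ _ _)) => //.
  + by rewrite mulr_ge0// ltW.
  + rewrite -mulrA nl2; nra.
  + move=> k /andP[k0 kl]; have kt : 0 <= k <= theta.
      by rewrite k0 (le_trans kl)// (le_trans ll0).
    have bE j : bounded_rv (fun w => expR (j * capped_cost x N L w)).
      exact: bounded_rv_expR_capped_cost.
    pose J := undup (reach N (0 : lattice d)).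
    have ES := @Efron_Stein R d P indep J _ (undup_uniq _) (bE (k / 2)).
    rewrite (@eq_mean _ _ _ P _ (fun w => expR (k / 2 * capped_cost x N L w) ^+ 2)); last first.
      by move=> w; rewrite -expRM_natr; congr expR; field.
    apply: le_trans (ES _) _.
      move=> w w' ww'; rewrite /capped_cost /truncated_cost.
      rewrite (@hit_local R d x (floored c w) (floored c w'))//.
      by move=> u uJ; rewrite /floored ww'// mem_undup.
    rewrite lerD2l.
    have bq z : bounded_rv (fun w => visit_prob x N z w * expR (k * capped_cost x N L w)).
      by apply: bounded_rvM; [exact: bounded_rv_visit_prob|exact: bE].
    have sumE (I : seq (lattice d)) : \sum_(z <- I) mean P (fun w => visit_prob x N z w
        * expR (k * capped_cost x N L w))
      = mean P (fun w => (\sum_(z <- I) visit_prob x N z w) * expR (k * capped_cost x N L w)).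
      elim: I => [|z I IH].
        rewrite big_nil -[LHS](mean_cst P 0); apply: eq_mean => w.
        by rewrite big_nil mul0r.
      rewrite big_cons IH -meanD//; last first.
        exact: (bounded_rvM (bounded_rv_sum_visit_prob I xN) (bE k)).
      by apply: eq_mean => w; rewrite big_cons mulrDl.
    apply: (@le_trans _ _ (\sum_(z <- J) k ^+ 2 * A1 * mean P (fun w => visit_prob x N z w
        * expR (k * capped_cost x N L w)))).
      by apply: ler_sum => z _; exact: influence_capped_cost_le.
    rewrite -mulr_sumr sumE.
    apply: (@le_trans _ _ (k ^+ 2 * A1 * (C * n%:R
        * mean P (fun w => expR (k * capped_cost x N L w))))).
      apply: (ler_wpM2l (mulr_ge0 (sqr_ge0 k) A10)); apply: visits => //.
      + by rewrite x0.
      + exact: undup_uniq.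
    rewrite (@eq_mean _ _ _ P (fun w => expR (k / 2 * capped_cost x N L w) ^+ 2)
      (fun w => expR (k * capped_cost x N L w))); last first.
      by move=> w; rewrite -expRM_natr; congr expR; field.
    by rewrite le_eqVlt; apply/orP; left; apply/eqP; rewrite /D; ring.
  + rewrite ler_expR [leLHS](_ : _ = 4 * D * (n%:R * l ^+ 2) + l ^+ 2); last ring.
    by rewrite nl2 [leRHS]mulrDl mul1r lerD2l lerXn2r ?nnegrE// ltW.
- by rewrite ler_expR lerN2 /l mulrAC mulrA.
Qed.

End TruncatedCost.

(** * The path sums are expectations for the walk *)

Section Trajectory.
Context {R : realType} {d : nat}.
Variable x : lattice d.
Implicit Types (V : lattice d -> R) (s : nat -> lattice d).

Fixpoint truncated_weight V N s : R :=
  if s 0%N == x then 1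
  else if N is M.+1 then
    expR (- V (s 0%N)) * truncated_weight V M (fun k => s k.+1)
  else 0.

Lemma truncated_weight_ge0 V N s : 0 <= truncated_weight V N s.
Proof.
by elim: N s => [|N IH] s /=; case: ifP => //= _; rewrite mulr_ge0 ?expR_ge0.
Qed.

Lemma truncated_weight_mono V N s :
  truncated_weight V N s <= truncated_weight V N.+1 s.
Proof.
elim: N s => [|N IH] s.
  by rewrite /=; case: eqVneq => // _; rewrite mulr_ge0 ?expR_ge0//; case: ifP.
rewrite [leLHS]/= [leRHS]/=; case: ifP => // _.
by rewrite ler_wpM2l ?expR_ge0.
Qed.

Lemma truncated_weight_hit V n N s : s n = x -> (forall k, (k < n)%N -> s k != x) ->
  (n <= N)%N -> truncated_weight V N s = expR (- \sum_(k < n) V (s k)).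
Proof.
elim: n N s => [|n IH] N s sn sk nN.
  by rewrite big_ord0 oppr0 expR0; case: N {nN} => [|N] /=; rewrite sn eqxx.
case: N nN => // N nN; rewrite /= (negPf (sk 0%N isT)) big_ord_recl opprD expRD.
by rewrite (IH N (fun k => s k.+1))// => k kn; exact: sk.
Qed.

Lemma truncated_weight_nohit V N s : (forall k, s k != x) ->
  truncated_weight V N s = 0.
Proof.
elim: N s => [|N IH] s sx /=; rewrite (negPf (sx _))//.
by rewrite IH ?mulr0// => k; exact: sx.
Qed.

Lemma cvg_truncated_weight (w : potential R d) s :
  truncated_weight (fun u => site u w) N s @[N --> \oo] --> travel_weight w x s.
Proof.
rewrite /travel_weight /hitting_time; case: pselect => [hit|nohit].
  case: ex_minnP => n /eqP sn nmin; apply: cvg_near_cst; exists n => // N /= nN.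
  apply: truncated_weight_hit => // k; rewrite ltnNge; apply: contraNN => /eqP sk.
  by apply: nmin; rewrite sk.
apply: cvg_near_cst; exists 0%N => // N _; apply: truncated_weight_nohit => k.
by apply/negP => sk; apply: nohit; exists k.
Qed.

End Trajectory.

Section Walk.
Context {R : realType} {d : nat} (d0 : (0 < d)%N).
Context {dW : measure_display} {W : measurableType dW}.
Variables (S : nat -> W -> lattice d) (P : probability W R).
Hypothesis srw : simple_random_walk S 0 P.
Variable x : lattice d.

Let mS k : measurable_fun setT (S k). Proof. by case: srw. Qed.

Lemma measurable_lattice_fun dU (U : measurableType dU) (g : lattice d -> U) :
  measurable_fun setT g.
Proof. by []. Qed.

Lemma measurable_truncated_weight V N j :
  measurable_fun setT (fun w => truncated_weight x V N (fun k => S (j + k)%N w) : R).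
Proof.
elim: N j => [|N IH] j /=; apply: measurable_fun_ifT; try exact: measurable_cst.
- exact: (measurableT_comp (measurable_lattice_fun (fun u => u == x)) (mS _)).
- exact: (measurableT_comp (measurable_lattice_fun (fun u => u == x)) (mS _)).
apply: measurable_funM.
  exact: (measurableT_comp (measurable_lattice_fun (fun u => expR (- V u))) (mS _)).
by under eq_fun do under eq_fun do rewrite addnS -addSn; exact: IH.
Qed.

Lemma l1norm_step (s : 'I_d * bool) : l1norm (step s) = 1%N.
Proof.
rewrite /l1norm (bigD1 s.1)//= step_coord eqxx big1 ?addn0; first by case: s.2.
by move=> i si; rewrite step_coord (negPf si).
Qed.

Lemma step_inj : injective (@step d).
Proof.
move=> [i b] [j b'] /(congr1 (fun u : lattice d => (u : 'rV[int]_d) 0 i)).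
rewrite !step_coord/= eqxx; case: eqVneq => [->|_]; case: b; case: b' => //.
Qed.

Definition prefix_event (a : seq ('I_d * bool)) : set W :=
  [set w | S 0%N w = 0 /\ forall i, (i < size a)%N ->
    S i.+1 w - S i w = step (nth (Ordinal d0, true) a i)].

Lemma prefix_event_nil : P (prefix_event [::]) = 1%E.
Proof.
have [_ <- _ _] := srw; congr (P _); apply/seteqP; split => w; first by case.
by split.
Qed.

Lemma countable_lattice : countable [set: lattice d].
Proof. exact: (countableP [set: 'rV[int]_d]). Qed.

(** The increments take countably many values, so that their events are countable
unions of events for two positions. *)
Lemma measurable_increment i u : measurable ((fun w => S i.+1 w - S i w) @^-1` [set u]).
Proof.
have -> : (fun w => S i.+1 w - S i w) @^-1` [set u] =
    \bigcup_v (S i @^-1` [set v] `&` S i.+1 @^-1` [set u + v]).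
  apply/seteqP; split => [w <-|w [v _] [/= -> ->]]; last by rewrite /= addrK.
  by exists (S i w) => //; split => //=; rewrite subrK.
apply: countable_bigcupT_measurable => [|v]; first exact: countable_lattice.
by apply: measurableI; rewrite -[X in measurable X]setTI; exact: mS.
Qed.

Lemma prob_prefix_event a : measurable (prefix_event a) ->
  P (prefix_event a) = ((2 * d)%:R^-1 ^+ size a)%:E.
Proof.
move=> ma; have [_ P0 ind law] := srw.
pose B i : set (lattice d) := [set step (nth (Ordinal d0, true) a i)].
have m0 : measurable [set w | S 0%N w = 0].
  have -> : [set w | S 0%N w = 0] = S 0%N @^-1` [set 0] by [].
  by rewrite -[X in measurable X]setTI; exact: mS.
have aE : prefix_event a = [set w | S 0%N w = 0]
    `&` \bigcap_(i in [set` iota 0 (size a)]) ((fun w => S i.+1 w - S i w) @^-1` B i).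
  apply/seteqP; split => w [w0 wa]; split => // i.
    by rewrite /= mem_iota => ia; exact: wa.
  by move=> ia; apply: (wa i); rewrite /= mem_iota.
have PB : P (\bigcap_(i in [set` iota 0 (size a)])
    ((fun w => S i.+1 w - S i w) @^-1` B i)) = ((2 * d)%:R^-1 ^+ size a)%:E.
  rewrite (ind _ B (iota_uniq _ _))//.
  rewrite (eq_bigr (fun=> ((2 * d)%:R^-1)%:E)); last first.
    move=> i _; have := law i (step (nth (Ordinal d0, true) a i)).
    by rewrite l1norm_step eqxx.
  by rewrite prodEFin big_const_seq count_predT size_iota iter_mulr mulr1.
have mB : measurable (\bigcap_(i in [set` iota 0 (size a)])
    ((fun w => S i.+1 w - S i w) @^-1` B i)).
  apply: fin_bigcap_measurable => [|i _]; first exact: finite_seq.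
  exact: measurable_increment.
have m0C : measurable (~` [set w | S 0%N w = 0]) by exact: measurableC.
rewrite -PB aE setIC -[in RHS](setIT (\bigcap_(i in _) _)) -(setvU [set w | S 0%N w = 0]).
rewrite setIUr setUC measureU0//; [exact: measurableI|exact: measurableI|].
apply: (@subset_measure0 _ _ _ _ _ (~` [set w | S 0%N w = 0])).
- exact: measurableI.
- exact: m0C.
- exact: subIsetr.
- by have := probability_setC P m0; rewrite P0 subee.
Qed.

Lemma integral_prefix_cst a (r : R) : measurable (prefix_event a) ->
  (\int[P]_(w in prefix_event a) r%:E = ((2 * d)%:R^-1 ^+ size a * r)%:E)%E.
Proof.
move=> ma; rewrite integral_cst// [X in (_ * X)%E](prob_prefix_event ma).
by rewrite -EFinM mulrC.
Qed.

Lemma prefix_event_rcons a s : prefix_event (rcons a s) =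
  prefix_event a `&` [set w | S (size a).+1 w - S (size a) w = step s].
Proof.
apply/seteqP; split => w.
  move=> [w0 wa]; split; first split => // i ia.
    by have := wa i; rewrite size_rcons nth_rcons ia; apply; exact: ltnW.
  by have := wa (size a); rewrite size_rcons nth_rcons ltnn eqxx; exact.
move=> [[w0 wa] ws]; split => // i; rewrite size_rcons ltnS leq_eqVlt nth_rcons.
by move=> /predU1P[->|ia]; [rewrite ltnn eqxx|rewrite ia; exact: wa].
Qed.

(** The Markov property at the end of the prefix [a].  Up to a null set a prefix event
is the disjoint union of its one-step extensions, which reproduces the recursion
defining [hit]. *)
Lemma integral_prefix_event V N a y : (forall u, 0 <= V u) ->
  measurable (prefix_event a) ->
  (forall w, prefix_event a w -> S (size a) w = y) ->
  (\int[P]_(w in prefix_event a)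
     (truncated_weight x V N (fun k => S (size a + k)%N w))%:E
   = ((2 * d)%:R^-1 ^+ size a * hit x V N y)%:E)%E.
Proof.
move=> V0; elim: N a y => [|N IH] a y ma ay.
  under eq_integral => w wa.
    rewrite /= addn0 ay; last by rewrite inE in wa.
    over.
  exact: integral_prefix_cst.
have [yx|yx] := eqVneq y x.
  under eq_integral => w wa.
    rewrite /= addn0 ay; last by rewrite inE in wa.
    rewrite yx eqxx; over.
  by rewrite yx hit_target; exact: integral_prefix_cst.
have Eas s : prefix_event (rcons a s) =
    prefix_event a `&` S (size a).+1 @^-1` [set y + step s].
  rewrite prefix_event_rcons; apply/seteqP; split => w [wa /= ws]; split => //.
    by rewrite -ws ay// addrC subrK.
  by rewrite /= ws ay// addrC addKr.
have mas s : measurable (prefix_event (rcons a s)).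
  rewrite Eas; apply: measurableI => //.
  by rewrite -[X in measurable X]setTI; exact: mS.
pose D := \big[setU/set0]_(s <- enum {: 'I_d * bool}) prefix_event (rcons a s).
have mD : measurable D by apply: bigsetU_measurable => s _.
have Da : D `<=` prefix_event a.
  by rewrite /D => w; rewrite -bigcup_seq => -[s _]; rewrite Eas => -[].
have tD : trivIset [set` enum {: 'I_d * bool}] (fun s => prefix_event (rcons a s)).
  move=> s s' _ _ [w []]; rewrite !Eas => -[_ /= ->] [_ /= /addrI].
  exact: step_inj.
have dd0 : (2 * d)%:R != 0 :> R by rewrite pnatr_eq0 -lt0n muln_gt0.
have PD : P D = ((2 * d)%:R^-1 ^+ size a)%:E.
  have <- : (\int[P]_(w in D) cst 1 w = P D)%E by rewrite integral_cst// mul1e.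
  rewrite ge0_integral_bigsetU ?enum_uniq//.
  rewrite (eq_bigr (fun=> ((2 * d)%:R^-1 ^+ (size a).+1)%:E)); last first.
    by move=> s _; rewrite integral_prefix_cst// mulr1 size_rcons.
  rewrite big_enum/= sumEFin sumr_const card_step; congr (_%:E).
  by rewrite exprS -mulrnAl -[_ *+ _]mulr_natr mulVf// mul1r.
have f0 w : 0 <= truncated_weight x V N.+1 (fun k => S (size a + k)%N w).
  exact: truncated_weight_ge0.
have mf : measurable_fun setT (fun w =>
    (truncated_weight x V N.+1 (fun k => S (size a + k)%N w))%:E).
  by apply/measurable_EFinP; exact: measurable_truncated_weight.
have -> : prefix_event a = D `|` (prefix_event a `\` D) by rewrite setDUK.
rewrite ge0_integral_setU//; first last.
- by rewrite disj_set2E setDIK.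
- by move=> w _; rewrite lee_fin.
- exact: measurable_funTS.
- exact: measurableD.
rewrite [X in (_ + X)%E]null_set_integral; [|exact: measurableD
  |exact: measurable_funTS|]; last first.
  rewrite measureD//; last by rewrite [X in (X < _)%E](prob_prefix_event ma) ltry.
  by rewrite (setIidr Da) [X in (X - _)%E](prob_prefix_event ma) [X in (_ - X)%E]PD subee.
rewrite adde0 ge0_integral_bigsetU ?enum_uniq//;
  [|exact: measurable_funTS|by move=> w _; rewrite lee_fin].
have one_step s : (\int[P]_(w in prefix_event (rcons a s))
      (truncated_weight x V N.+1 (fun k => S (size a + k)%N w))%:E
    = (expR (- V y))%:E * ((2 * d)%:R^-1 ^+ (size a).+1 * hit x V N (y + step s))%:E)%E.
  rewrite -(size_rcons a s) -(IH (rcons a s)); [|exact: mas|]; last first.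
    by move=> w; rewrite Eas size_rcons => -[_ ->].
  rewrite -ge0_integralZl//; first last.
  - by move=> w _; rewrite lee_fin truncated_weight_ge0.
  - apply: measurable_funTS.
    by apply/measurable_EFinP; exact: measurable_truncated_weight.
  apply: eq_integral => w; rewrite inE Eas => -[wa _].
  rewrite -EFinM /= addn0 ay// (negPf yx); congr (_ * _)%:E.
  by congr truncated_weight; apply/funext => k; rewrite size_rcons addnS addSn.
under eq_bigr do rewrite one_step -EFinM.
rewrite hitS// big_enum/= sumEFin; congr (_%:E).
rewrite /avg -!mulr_sumr exprS; ring.
Qed.

Lemma expectation_truncated_weight V N : (forall u, 0 <= V u) ->
  (\int[P]_w (truncated_weight x V N (S ^~ w))%:E = (hit x V N 0)%:E)%E.
Proof.
move=> V0; have [_ P0 _ _] := srw.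
have m0 : measurable (prefix_event [::]).
  have -> : prefix_event [::] = S 0%N @^-1` [set 0].
    by apply/seteqP; split => w; [case|split].
  by rewrite -[X in measurable X]setTI; exact: mS.
have h := @integral_prefix_event V N [::] 0 V0 m0 (fun w wa => wa.1).
rewrite /= expr0 mul1r in h; rewrite -h.
have mf : measurable_fun setT (fun w => (truncated_weight x V N (S ^~ w))%:E).
  apply/measurable_EFinP; exact: (measurable_truncated_weight V N 0).
rewrite -(setvU (prefix_event [::])) ge0_integral_setU//; first last.
- by rewrite disj_set2E setICl.
- by move=> w _; rewrite lee_fin truncated_weight_ge0.
- by rewrite setvU.
- exact: measurableC.
rewrite null_set_integral ?add0e//; first exact: measurableC.
- exact: measurable_funTS.
- by have := probability_setC P m0; rewrite prefix_event_nil subee.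
Qed.

(** Monotone convergence: the weight of a trajectory is the increasing limit of its
truncations. *)
Lemma cvg_hit_travel_e (Px : lattice d -> probability W R) (w : potential R d) :
  Px 0 = P ->
  hit x (fun u => site u w) N 0 @[N --> \oo] --> travel_e S Px 0 x w.
Proof.
move=> PxP; rewrite /travel_e PxP unlock.
set V := fun u => site u w.
have V0 u : 0 <= V u by exact: site_ge0.
pose g N (v : W) := (truncated_weight x V N (S ^~ v))%:E.
have mg N : measurable_fun setT (g N).
  by apply/measurable_EFinP; exact: (measurable_truncated_weight V N 0).
have g0 N v : setT v -> (0 <= g N v)%E.
  by move=> _; rewrite lee_fin truncated_weight_ge0.
have gnd v : setT v -> {homo g ^~ v : n m / (n <= m)%N >-> (n <= m)%E}.
  move=> _; apply/nondecreasing_seqP => n; rewrite lee_fin.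
  exact: truncated_weight_mono.
have := cvg_monotone_convergence (mu := P) measurableT mg g0 gnd.
have -> : (fun n => \int[P]_v g n v)%E = (fun N => (hit x V N 0)%:E).
  by apply/funext => N; exact: expectation_truncated_weight.
have -> : (\int[P]_v limn (g ^~ v))%E = (\int[P]_v (travel_weight w x (S ^~ v))%:E)%E.
  apply: eq_integral => v _; apply/cvg_lim => //.
  by apply: cvg_EFin; [exact: nearW|exact: cvg_truncated_weight].
set l := (\int[P]_v _)%E => hl.
have l01 : (0 <= l <= 1)%E.
  apply/andP; split.
    by apply: (cvge_to_ge hl); apply: nearW => N; rewrite lee_fin hit_ge0.
  by apply: (cvge_to_le hl); apply: nearW => N; rewrite lee_fin hit_le1.
have lfin : l \is a fin_num.
  by case/andP: l01 => l0 l1; rewrite ge0_fin_numE// (le_lt_trans l1)// ltry.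
by move: hl; rewrite -(fineK lfin) => /fine_cvg.
Qed.

End Walk.

(** * The travel cost as a limit of truncated costs *)

Section TravelCost.
Context {R : realType} {d : nat} (d0 : (0 < d)%N).
Context {dW : measure_display} {W : measurableType dW}.
Variables (S : nat -> W -> lattice d) (Px : lattice d -> probability W R).
Hypothesis srw : simple_random_walk S 0 (Px 0).
Variable P : probability (potential R d) R.
Variable c : R.
Hypothesis floor_ae : {ae P, forall w, forall z, floored c w z = site z w}.
Variable x : lattice d.

Let e_ N (w : potential R d) := hit x (fun u => site u w) N 0.
Let e (w : potential R d) := travel_e S Px 0 x w.

Let e_cvg w : e_ N w @[N --> \oo] --> e w.
Proof. exact: (cvg_hit_travel_e d0 srw (erefl (Px 0))). Qed.

Let e_lim w : limn (e_ ^~ w) = e w.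
Proof. by apply/cvg_lim => //; exact: e_cvg. Qed.

Let e_is_cvg w : cvgn (e_ ^~ w).
Proof. by apply/cvg_ex; exists (e w); exact: e_cvg. Qed.

Lemma travel_e_ge_hit N w : hit x (fun u => site u w) N 0 <= travel_e S Px 0 x w.
Proof.
have nd : {homo e_ ^~ w : n m / (n <= m)%N >-> n <= m}.
  by apply/nondecreasing_seqP => n; exact: hit_mono.
by have := nondecreasing_cvgn_le nd (e_is_cvg (w := w)) N; rewrite e_lim.
Qed.

Lemma travel_e_gt0 w : 0 < travel_e S Px 0 x w.
Proof.
exact: lt_le_trans (hit_gt0 d0 (fun u => site u w) (leqnn _)) (travel_e_ge_hit _ w).
Qed.

Lemma travel_cost_le_truncated N w : (l1norm x <= N)%N ->
  travel_cost S Px 0 x w <= truncated_cost c x N w.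
Proof.
move=> xN; rewrite lerN2 ler_ln ?posrE ?travel_e_gt0 ?hit_gt0//.
apply: le_trans (travel_e_ge_hit N w).
by apply: hit_antitone => u; exact: site_le_floored.
Qed.

Lemma measurable_travel_cost : measurable_fun setT (travel_cost S Px 0 x).
Proof.
apply: (measurableT_comp (@oppr_measurable R setT)).
apply: (measurableT_comp (@measurable_ln R)).
apply: (@measurable_fun_cvg _ _ _ _ e_) => [N|w _]; last exact: e_cvg.
apply: (@measurable_hit _ _ _ _ x (fun w u => site u w)) => z.
exact: measurable_site.
Qed.

Lemma cvg_truncated_cost : {ae P, forall w,
  truncated_cost c x N w @[N --> \oo] --> travel_cost S Px 0 x w}.
Proof.
apply: filterS floor_ae => w wc.
have -> : truncated_cost c x ^~ w = (fun N => - ln (e_ N w)).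
  apply/funext => N; rewrite /truncated_cost /e_; congr (- ln _).
  by apply: hit_local => u _; exact: wc.
rewrite -[travel_cost _ _ _ _ _]/(- ln (e w)).
apply: (cvgN (f := fun N => ln (e_ N w))).
exact: (@continuous_cvg _ _ _ _ _ (e_ ^~ w) (@ln R) (e w)
  (continuous_ln (travel_e_gt0 w)) (e_cvg (w := w))).
Qed.

(** Dominated convergence, the costs being dominated by the one for [N] equal to
the norm of [x], which has an exponential moment. *)
Lemma mean_truncated_cost gamma (B : R) : 0 < gamma ->
  (\int[P]_w (expR (gamma * truncated_cost c x (l1norm x) w))%:E <= B%:E)%E ->
  exists m : R, ('E_P[travel_cost S Px 0%R x] = m%:E)%E /\
  exists2 N, (l1norm x <= N)%N & (\int[P]_w (truncated_cost c x N w)%:E <= (m + 1)%:E)%E.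
Proof.
move=> gamma0 hB; set n := l1norm x in hB *.
pose f k w := (truncated_cost c x (k + n) w)%:E.
pose Z w := (travel_cost S Px 0 x w)%:E.
have mexp : measurable_fun setT (fun w => (expR (gamma * truncated_cost c x n w))%:E).
  apply/measurable_EFinP; apply: (measurableT_comp (@measurable_expR R)).
  by apply: measurable_funM; [exact: measurable_cst|exact: measurable_truncated_cost].
have mf k : measurable_fun setT (f k).
  by apply/measurable_EFinP; exact: measurable_truncated_cost.
have ig : P.-integrable setT (fun w => (truncated_cost c x n w)%:E).
  apply/integrableP; split.
    by apply/measurable_EFinP; exact: measurable_truncated_cost.
  apply: (@le_lt_trans _ _ (\int[P]_w ((gamma^-1)%:E * (expR (gamma * truncated_cost c x n w))%:E))%E).
    apply: ge0_le_integral => //.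
    - apply/measurableT_comp => //.
      by apply/measurable_EFinP; exact: measurable_truncated_cost.
    - by apply: emeasurable_funM; [exact: measurable_cst|exact: mexp].
    - move=> w _; rewrite gee0_abs ?lee_fin ?truncated_cost_ge0//.
      rewrite ler_pdivlMl// (le_trans _ (expR_ge1Dx _))// lerDr//.
  rewrite ge0_integralZl//; last by rewrite lee_fin invr_ge0 ltW.
  apply: (@le_lt_trans _ _ ((gamma^-1)%:E * B%:E)%E); last by rewrite -EFinM ltry.
  by apply: lee_wpmul2l => //; rewrite lee_fin invr_ge0 ltW.
have cost_mono k w : truncated_cost c x (k + n) w <= truncated_cost c x n w.
  rewrite lerN2 ler_ln ?posrE ?hit_gt0 ?leq_addl//.
  elim: k => [//|k IH].
  by rewrite addSn (le_trans IH)// hit_mono.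
have [iZ _ cvgI] : [/\ P.-integrable setT Z,
    (\int[P]_w `|f k w - Z w|)%E @[k --> \oo] --> 0%E
    & (\int[P]_w f k w)%E @[k --> \oo] --> (\int[P]_w Z w)%E].
  apply: (dominated_convergence measurableT mf _ _ ig).
  - by apply/measurable_EFinP; exact: measurable_travel_cost.
  - apply: filterS cvg_truncated_cost => w cw _.
    apply: cvg_EFin; first exact: nearW.
    by rewrite (cvg_shiftn n (truncated_cost c x ^~ w)).
  - by apply: aeW => w k _; rewrite /f gee0_abs ?lee_fin ?truncated_cost_ge0//.
have fZ := integrable_fin_num measurableT iZ.
exists (fine (\int[P]_w Z w)); rewrite fineK// unlock; split => //.
move: cvgI; rewrite -(fineK fZ); set m := fine _ => cvgI.
have near_m : nbhs m%:E [set y | (y < (m + 1)%:E)%E].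
  by apply: open_ereal_lt'; rewrite lte_fin ltrDl.
have [k _ /(_ k (leqnn k)) hk] := cvgI _ near_m.
by exists (k + n)%N; [exact: leq_addl|exact: ltW].
Qed.

(** Stopping the walk raises the cost, hence its upper tail events; its mean rises
by at most 1 when [N] is large, which is the loss in [s - 1].  Capping at a level
above the threshold makes the variable bounded without changing the event. *)
Lemma travel_cost_tail C1 C2 gamma (B s : R) : 0 < gamma ->
  (0 < l1norm x)%N ->
  (\int[P]_w (expR (gamma * truncated_cost c x (l1norm x) w))%:E <= B%:E)%E ->
  (forall N L r, (l1norm x <= N)%N -> 0 <= L ->
    (P [set w | (mean P (capped_cost c x N L) + r <= capped_cost c x N L w)%R]
    <= (C1 * expR (- (C2 * (r / Num.sqrt (l1norm x)%:R))))%:E)%E) ->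
  (P [set w | (s%:E <= (travel_cost S Px 0%R x w)%:E - 'E_P[travel_cost S Px 0%R x])%E]
   <= (C1 * expR (- (C2 * ((s - 1) / Num.sqrt (l1norm x)%:R))))%:E)%E.
Proof.
move=> gamma0 x0 hB tail; have [m [-> [N xN mN]]] := mean_truncated_cost gamma0 hB.
pose L := Num.max 0 (m + s); have L0 : 0 <= L by rewrite le_max lexx.
have bY := bounded_rv_capped_cost d0 c x N L0.
have mY : mean P (capped_cost c x N L) <= m + 1.
  rewrite -lee_fin -(integral_bounded_rv P bY) (le_trans _ mN)//.
  apply: ge0_le_integral => //.
  - by move=> w _; rewrite lee_fin capped_cost_ge0.
  - by apply/measurable_EFinP; case: bY.
  - by apply/measurable_EFinP; exact: measurable_truncated_cost.
  - by move=> w _; rewrite lee_fin ge_min lexx.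
apply: le_trans (tail N L (s - 1) xN L0).
have mge (g : potential R d -> R) a : measurable_fun setT g -> measurable [set w | a <= g w].
  move=> mg; have -> : [set w | a <= g w] = g @^-1` `[a, +oo[.
    by apply/seteqP; split => w /=; rewrite in_itv/= andbT.
  by rewrite -[X in measurable X]setTI; apply: mg.
have AE : [set w | (s%:E <= (travel_cost S Px 0%R x w)%:E - m%:E)%E]
    = [set w | m + s <= travel_cost S Px 0 x w].
  by apply/seteqP; split => w /=; rewrite -EFinB lee_fin lerBrDl.
rewrite AE; apply: le_measure; rewrite ?inE.
- by apply: mge; exact: measurable_travel_cost.
- by apply: mge; case: bY.
move=> w /= h; rewrite /capped_cost le_min; apply/andP; split.
  by have := travel_cost_le_truncated w xN; lra.
by rewrite le_max; apply/orP; right; lra.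
Qed.

End TravelCost.

(** * Constants depending on the law of the potential *)

Section Law.
Context {R : realType} {d : nat}.
Variable P : probability (potential R d) R.
Hypothesis ident : identically_distributed P (@site R d).

Lemma floored0 (w : potential R d) z : floored 0 w z = site z w.
Proof. by rewrite /floored max_r// site_ge0. Qed.

(** The support is closed, so if it lies in the positive half-line then it is
bounded away from 0. *)
Lemma floor_of_positive_support :
  topological_support (distribution P (@site R d 0)) `<=` `]0, +oo[ ->
  exists2 c : R, 0 < c & {ae P, forall w, forall z, floored c w z = site z w}.
Proof.
move=> supp; have : ~ topological_support (distribution P (@site R d 0)) 0.
  by move=> /supp /=; rewrite in_itv/= ltxx.
move=> /existsNP[V] /not_implyP[oV] /not_implyP[V0] /negP; rewrite -leNgt => PV.
have [r /= r0 rV] : nbhs_ball (0 : R) V by apply/nbhs_ballP; exact: open_nbhs_nbhs.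
exists r => //.
have mV : measurable V by exact: open_measurable.
have Pz z : P (site z @^-1` V) = 0%E.
  apply/eqP; rewrite eq_le measure_ge0 andbT (le_trans _ PV)//.
  by rewrite (ident z 0 mV).
have aez : {ae P, forall w, forall z, ~ V (site z w)}.
  have : {ae P, forall w, forall n,
      if @unpickle 'rV[int]_d n is Some z then ~ V (site z w) else True}.
    apply: ae_foralln => n; case: (unpickle n) => [z|]; last exact: aeW.
    exists (site z @^-1` V); split; [|exact: Pz|by move=> w /= /contrapT].
    by rewrite -[X in measurable X]setTI; exact: measurable_site.
  by apply: filterS => w wV z; have := wV (@pickle 'rV[int]_d z); rewrite pickleK.
apply: filterS aez => w wV z; rewrite /floored max_r// leNgt; apply/negP => zr.
apply: (wV z); apply: rV; rewrite /ball/= sub0r normrN ger0_norm// site_ge0//.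
Qed.

(** With [k] the mean of [expR (- site 0 w)], the choice [eps = 1 - k] works since
[k <= expR (k - 1)]. *)
Lemma killing_exponent : ~ {ae P, forall w, site 0 w = 0} ->
  exists2 eps : R, 0 < eps & (\int[P]_w (expR (eps - site (0%R : lattice d) w))%:E <= 1)%E.
Proof.
move=> nontrivial.
pose g (w : potential R d) := expR (- site 0 w).
have mg : measurable_fun setT g.
  apply: (measurableT_comp (@measurable_expR R)).
  exact: (measurableT_comp (@oppr_measurable R setT) (measurable_site 0)).
have g1 w : g w <= 1 by rewrite expR_le1 oppr_le0 site_ge0.
have bg : bounded_rv g.
  by split => //; exists 1 => w; rewrite ger0_norm ?expR_ge0.
have b1g : bounded_rv (fun w => 1 - g w) by exact: (bounded_rvB (bounded_rv_cst 1) bg).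
set k := mean P g.
have k1 : k < 1.
  rewrite lt_neqAle; apply/andP; split; last first.
    by rewrite -(mean_cst P 1); apply: le_mean => //; exact: bounded_rv_cst.
  apply/eqP => kE; apply: nontrivial.
  have : (\int[P]_w `|(1 - g w)%:E| = 0)%E.
    under eq_integral do rewrite gee0_abs ?lee_fin ?subr_ge0//.
    rewrite (integral_bounded_rv P b1g) (meanB _ (bounded_rv_cst 1) bg) mean_cst.
    by rewrite -/k kE subrr.
  move/(ae_eq_integral_abs P measurableT).
  have m1g : measurable_fun setT (fun w => (1 - g w)%:E).
    by apply/measurable_EFinP; case: b1g.
  move=> /(_ m1g); apply: filterS => w /(_ I) /= [] /eqP.
  rewrite subr_eq0 eq_sym => /eqP gw.
  by apply/eqP; rewrite -oppr_eq0 -(expRK (- site 0 w)) -/(g w) gw ln1.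
exists (1 - k); first by rewrite subr_gt0.
have bE : bounded_rv (fun w => expR (1 - k) * g w) by exact: (bounded_rvM (bounded_rv_cst _) bg).
rewrite (_ : (\int[P]_w _)%E = (\int[P]_w (expR (1 - k) * g w)%:E)%E); last first.
  by apply: eq_integral => w _; rewrite expRD.
rewrite (integral_bounded_rv P bE) (meanZ _ _ bg) -/k lee_fin.
rewrite -[leRHS](expRxMexpNx_1 (1 - k)) ler_wpM2l ?expR_ge0//.
by have := expR_ge1Dx (- (1 - k)); lra.
Qed.

End Law.

Theorem theorem1p3 (R : realType) (d : nat) (d_ge2 : (2 <= d)%N)
  (dW : measure_display) (W : measurableType dW)
  (S : nat -> W -> lattice d) (Px : lattice d -> probability W R)
  (srw : forall x : lattice d, simple_random_walk S x (Px x))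
  (P : probability (potential R d) R)
  (indep : mutually_independent P (@site R d))
  (ident : identically_distributed P (@site R d))
  (nontrivial : ~ {ae P, forall omega, site 0 omega = 0})
  (exp_moment : exists2 gamma : R, 0 < gamma &
     ('E_P[fun omega => (expR (gamma * site (0%R : lattice d) omega))%R] < +oo)%E)
  (pos_support : d = 2%N ->
     topological_support (distribution P (@site R d 0%R)) `<=` `]0, +oo[) :
  exists C1 C2 : R, [/\ 0 < C1, 0 < C2 &
    exists N : nat, forall x : lattice d, (N <= l1norm x)%N ->
      forall t : R, 0 <= t ->
        (P [set omega |
             (travel_cost S Px (0%R : lattice d) x omega)%:E - 'E_P[travel_cost S Px (0%R : lattice d) x]
               >= (t * Num.sqrt (l1norm x)%:R)%:E]
         <= (C1 * expR (- (C2 * t)))%:E)%E].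
Proof.
have d0 : (0 < d)%N by exact: leq_trans d_ge2.
(* In dimension 2 loops are bounded by killing, hence the floor [c > 0]; in
   higher dimension transience allows [c = 0]. *)
have [c [K [c0 K1 loops floor_ae]]] : exists c K : R, [/\ 0 <= c, 1 <= K,
    loops_bounded d c K & {ae P, forall w, forall z, floored c w z = site z w}].
  move: (d_ge2); rewrite leq_eqVlt => /orP[/eqP d2|d3].
    have [c c_gt0 fl] := floor_of_positive_support ident (pos_support (esym d2)).
    have [K K1 loops] := loops_bounded_killing d0 c_gt0.
    by exists c, K; split => //; exact: ltW.
  have [K K1 loops] := @loops_bounded_transience R d d3.
  by exists 0, K; split => //; apply: aeW => w z; exact: floored0.
have [gamma gamma0 mom] := exp_moment.
have [Bg moment] : exists Bg : R,
    (\int[P]_w (expR (gamma * site (0%R : lattice d) w))%:E <= Bg%:E)%E.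
  exists (fine ('E_P[fun w => expR (gamma * site (0%R : lattice d) w)])%E).
  rewrite fineK; last first.
    rewrite ge0_fin_numE// unlock; apply: integral_ge0 => w _.
    by rewrite lee_fin expR_ge0.
  by rewrite unlock.
have [eps eps0 killing] := killing_exponent nontrivial.
pose theta := Num.min gamma 1 / 4.
have theta0 : 0 < theta by rewrite divr_gt0// lt_min gamma0 ltr01.
have theta1 : 4 * theta <= 1 by rewrite /theta mulrC divfK// ge_min lexx orbT.
have theta_gamma : 4 * theta <= gamma by rewrite /theta mulrC divfK// ge_min lexx.
have [C1 [C2 [C1_gt0 C2_gt0 tail]]] := capped_cost_concentration d0 indep ident c0 K1
  loops gamma0 moment theta0 theta1 theta_gamma eps0 killing.
have [B _ costB] := integral_expR_truncated_cost d0 indep ident c0 gamma0 moment.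
exists (C1 * expR C2), C2; split => //; first by rewrite mulr_gt0 ?expR_gt0.
exists 1%N => x x1 t t0.
have sn1 : 1 <= Num.sqrt (l1norm x)%:R :> R.
  by rewrite -[leLHS]sqrtr1 ler_sqrt// ler1n.
have sn0 : 0 < Num.sqrt (l1norm x)%:R :> R by rewrite (lt_le_trans ltr01).
apply: (@le_trans _ _ (C1 * expR (- (C2 * ((t * Num.sqrt (l1norm x)%:R - 1)
    / Num.sqrt (l1norm x)%:R))))%:E).
  have tailx N L r (xN : (l1norm x <= N)%N) (L0 : 0 <= L) :=
    tail x N L r (introT andP (conj x1 xN)) L0.
  exact: (travel_cost_tail d0 (srw 0) floor_ae (t * Num.sqrt (l1norm x)%:R)
    gamma0 x1 (costB x _ (leqnn _)) tailx).
rewrite lee_fin -mulrA ler_pM2l// -expRD ler_expR.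
rewrite mulrBl mulfK ?gt_eqF// mul1r mulrBr opprB lerD2r.
by rewrite -[leRHS]mulr1 ler_pM2l// invf_le1.
Qed.
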